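(* Let $\alpha,\theta$ be nonconstant inner functions such that $\alpha\leqslant\theta$, and let $\tilde C$ be a conjugation on $K_\theta$. Assume that there are conjugations $C_1,C_2$ on $L^2$ with $M_zC_i=C_iM_{\bar z}$, $i=1,2$, such that $\tilde C|_{K_\alpha}=C_1|_{K_\alpha}$ and $\tilde C|_{K_\theta\ominus K_\alpha}=C_2|_{K_\theta\ominus K_\alpha}$. Then, up to unimodular constants (inner functions being identified up to multiplication by a unimodular constant), $\tilde C=C_\theta$ or $\tilde C=C_{\alpha,\frac{\theta}{\alpha}}$. Explicitly: either there is a constant $c\in\mathbb{C}$, $|c|=1$, such that $\tilde C=c\,C_\theta$ on $K_\theta$, or there are constants $c_1,c_2\in\mathbb{C}$, $|c_1|=|c_2|=1$, such that $\tilde C(f_1+\alpha f_2)=c_1C_\alpha f_1+c_2\,\alpha C_{\frac{\theta}{\alpha}}f_2$ for all $f_1\in K_\alpha$, $f_2\in K_{\frac{\theta}{\alpha}}$.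
   Context: A conjugation on a complex Hilbert space $\mathcal{H}$ is an antilinear map $C\colon\mathcal{H}\to\mathcal{H}$ with $C^2=I$ and $\langle Cf,Cg\rangle=\langle g,f\rangle$ for all $f,g\in\mathcal{H}$. $L^2=L^2(\mathbb{T},m)$ with $m$ normalized Lebesgue measure on the unit circle $\mathbb{T}$; $H^2\subset L^2$ is the Hardy space of the unit disc. $M_\varphi$ denotes multiplication by $\varphi$ on $L^2$. An inner function is $\theta\in H^\infty$ with $|\theta|=1$ a.e. on $\mathbb{T}$; the model space is $K_\theta=H^2\ominus\theta H^2$ (equal to $\{0\}$ if $\theta$ is constant). $\alpha\leqslant\theta$ means that $\frac{\theta}{\alpha}$ is an inner function; in that case $K_\theta=K_\alpha\oplus\alpha K_{\frac{\theta}{\alpha}}$ (orthogonal sum), so $K_\theta\ominus K_\alpha=\alpha K_{\frac{\theta}{\alpha}}$. For an inner function $\theta$, $C_\theta f=\theta\bar z\bar f$ for $f\in L^2$; this is a conjugation on $L^2$ which preserves $K_\theta$. The conjugation $C_{\alpha,\frac{\theta}{\alpha}}$ on $K_\theta$ is defined by $C_{\alpha,\frac{\theta}{\alpha}}(f_1+\alpha f_2)=C_\alpha f_1+\alpha C_{\frac{\theta}{\alpha}}f_2$ for $f_1\in K_\alpha$, $f_2\in K_{\frac{\theta}{\alpha}}$. *)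

(* Defs.v *)
From HB Require Import structures.
From mathcomp Require Import all_boot all_order all_algebra.
From mathcomp Require Import generic_quotient ring_quotient.
From mathcomp Require Import all_classical all_reals all_analysis.
From mathcomp Require Import measurable_realfun complex.

Set Implicit Arguments.
Unset Strict Implicit.
Unset Printing Implicit Defensive.

Import Order.TTheory GRing.Theory Num.Theory.
Import numFieldNormedType.Exports.

Local Open Scope classical_set_scope.
Local Open Scope ring_scope.
Local Open Scope complex_scope.
Local Open Scope quotient_scope.

(* Re and Im would otherwise refer to the projections of numClosedFieldType. *)
Local Notation Re := complex.Re.
Local Notation Im := complex.Im.

Section Circle.
Variable R : realType.

Record circle := Circle { cval :> R[i]; cvalP : `|cval| == 1 }.

HB.instance Definition _ := [isSub for cval].
HB.instance Definition _ := [Choice of circle by <:].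

Lemma circle1_subproof : `|1 : R[i]| == 1.
Proof. by rewrite normr1. Qed.

HB.instance Definition _ := isPointed.Build circle (Circle circle1_subproof).

Lemma expi_subproof (t : R) :
  `|cos (2 * pi * t) +i* sin (2 * pi * t)| == 1 :> R[i].
Proof. by rewrite normc_def /= cos2Dsin2 sqrtr1. Qed.

(* t |-> exp (2 i pi t) *)
Definition expi (t : R) : circle := Circle (expi_subproof t).

(* The sigma-algebra is { A | expi @^-1` A is Borel in R }.  It coincides with
   the Borel sigma-algebra of the circle, because expi is continuous and
   restricts to a Borel isomorphism from [0, 1[ onto the circle. *)
Definition circle_measurable : set_system circle :=
  image_set_system setT expi (@measurable _ R).

Let circle_sigma : sigma_algebra setT circle_measurable.
Proof.
apply: sigma_algebra_image; split; first exact: measurable0.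
- by move=> A mA; apply: measurableD.
- by move=> F mF; exact: bigcupT_measurable.
Qed.

Let circle_measurable0 : circle_measurable set0.
Proof. by have [] := circle_sigma. Qed.

Let circle_measurableC A : circle_measurable A -> circle_measurable (~` A).
Proof. by have [_ h _] := circle_sigma; move=> /h; rewrite setTD. Qed.

Let circle_measurable_bigcup (F : (set circle)^nat) :
  (forall i, circle_measurable (F i)) -> circle_measurable (\bigcup_i F i).
Proof. by have [_ _] := circle_sigma; apply. Qed.

HB.instance Definition _ := isMeasurable.Build default_measure_display circle
  circle_measurable0 circle_measurableC circle_measurable_bigcup.

Lemma measurable_expi : measurable_fun setT expi.
Proof.
move=> _ A mA; rewrite setTI; move: mA.
by rewrite /measurable/= /circle_measurable /image_set_system/= setTI.
Qed.

HB.instance Definition _ := isMeasurableFun.Build _ _ _ _ expi measurable_expi.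

Definition circle_measure : set circle -> \bar R :=
  pushforward (mrestr (@lebesgue_measure R) (measurable_itv `[0%R, 1%R])) expi.

Let circle_measure0 : circle_measure set0 = 0%E.
Proof. by rewrite /circle_measure /pushforward preimage_set0 measure0. Qed.

Let circle_measure_ge0 A : (0 <= circle_measure A)%E.
Proof. exact: measure_ge0. Qed.

Let circle_measure_sigma_additive : semi_sigma_additive circle_measure.
Proof.
move=> F mF tF mUF; rewrite /circle_measure /pushforward preimage_bigcup.
apply: measure_semi_sigma_additive.
- by move=> n; rewrite -[X in measurable X]setTI; exact: measurable_expi.
- apply/trivIsetP => /= i j _ _ ij; rewrite -preimage_setI.
  by move/trivIsetP : tF => /(_ _ _ _ _ ij) ->//; rewrite preimage_set0.
- by rewrite -preimage_bigcup -[X in measurable X]setTI; exact: measurable_expi.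
Qed.

HB.instance Definition _ := isMeasure.Build _ _ _ circle_measure
  circle_measure0 circle_measure_ge0 circle_measure_sigma_additive.

Lemma circle_measureT : circle_measure setT = 1%E.
Proof.
rewrite /circle_measure /pushforward preimage_setT /mrestr setTI.
by rewrite lebesgue_measure_itv /= lte01 sube0.
Qed.

HB.instance Definition _ := Measure_isProbability.Build _ _ _ circle_measure
  circle_measureT.

End Circle.

Arguments circle_measure {R}.

Section ComplexMeasurable.
Variable R : realType.
Local Notation C := R[i].
Local Notation T := (circle R).

Definition cmeasurable (f : T -> C) : Prop :=
  measurable_fun setT (fun x => Re (f x)) /\
  measurable_fun setT (fun x => Im (f x)).

Definition cmfun_pred : {pred T -> C} := mem [set f | cmeasurable f].

Lemma ReM (x y : C) : Re (x * y) = Re x * Re y - Im x * Im y.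
Proof. by case: x y => [a b] [c d]. Qed.

Lemma ImM (x y : C) : Im (x * y) = Re x * Im y + Im x * Re y.
Proof. by case: x y => [a b] [c d]. Qed.

Lemma ReB (x y : C) : Re (x - y) = Re x - Re y.
Proof. by case: x y => [a b] [c d]. Qed.

Lemma ImB (x y : C) : Im (x - y) = Im x - Im y.
Proof. by case: x y => [a b] [c d]. Qed.

Lemma cmeasurable_cst (c : C) : cmeasurable (fun=> c).
Proof. by split; exact: measurable_cst. Qed.

Lemma cmeasurableB (f g : T -> C) :
  cmeasurable f -> cmeasurable g -> cmeasurable (f - g).
Proof.
move=> [fr fi] [gr gi]; split.
- by under eq_fun do rewrite ReB; exact: measurable_funB.
- by under eq_fun do rewrite ImB; exact: measurable_funB.
Qed.

Lemma cmeasurableM (f g : T -> C) :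
  cmeasurable f -> cmeasurable g -> cmeasurable (f * g).
Proof.
move=> [fr fi] [gr gi]; split.
- under eq_fun do rewrite ReM.
  by apply: measurable_funB; exact: measurable_funM.
- under eq_fun do rewrite ImM.
  by apply: measurable_funD; exact: measurable_funM.
Qed.

Lemma cmeasurable_conj (f : T -> C) :
  cmeasurable f -> cmeasurable (fun x => conjc (f x)).
Proof.
move=> [fr fi]; split.
- rewrite (_ : (fun x => _) = (fun x => Re (f x))) //.
  by apply/funext => x; case: (f x).
- rewrite (_ : (fun x => _) = (fun x => - Im (f x))); first exact: measurable_funN.
  by apply/funext => x; case: (f x).
Qed.

Lemma measurable_invr : measurable_fun setT (@GRing.inv R).
Proof.
rewrite -(setUv [set 0 : R]); apply/measurable_funU => //.
  exact: measurableC.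
split; first exact: measurable_fun_set1.
apply: open_continuous_measurable_fun.
  apply: closed_openC.
  exact/accessible_closed_set1/hausdorff_accessible/Rhausdorff.
by move=> x; rewrite inE => /eqP x0; exact: inv_continuous.
Qed.

Lemma cmeasurableV (f : T -> C) :
  cmeasurable f -> cmeasurable (fun x => (f x)^-1).
Proof.
move=> [fr fi].
have m2 : measurable_fun setT
    (fun x => (Re (f x) ^+ 2 + Im (f x) ^+ 2)^-1).
  apply: (measurableT_comp measurable_invr).
  by apply: measurable_funD; exact: measurable_funX.
split.
- rewrite (_ : (fun x => _) =
    (fun x => Re (f x) * (Re (f x) ^+ 2 + Im (f x) ^+ 2)^-1)).
    exact: measurable_funM.
  by apply/funext => x; case: (f x).
- rewrite (_ : (fun x => _) =
    (fun x => - (Im (f x) * (Re (f x) ^+ 2 + Im (f x) ^+ 2)^-1))).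
    by apply: measurable_funN; exact: measurable_funM.
  by apply/funext => x; case: (f x) => a b /=; rewrite ?mulNr.
Qed.

Lemma cmeasurable_cval : cmeasurable (@cval R).
Proof.
have mcos : measurable_fun setT (fun t : R => cos (2 * pi * t)).
  apply: continuous_measurable_fun => t; apply: continuous_comp.
    exact: mulrl_continuous.
  exact: continuous_cos.
have msin : measurable_fun setT (fun t : R => sin (2 * pi * t)).
  apply: continuous_measurable_fun => t; apply: continuous_comp.
    exact: mulrl_continuous.
  exact: continuous_sin.
by split => _ B mB; rewrite setTI; [exact: mcos | exact: msin].
Qed.

Lemma cmfun_subring_closed : subring_closed cmfun_pred.
Proof.
split=> [|f g|f g]; rewrite !inE /=.
- exact: cmeasurable_cst.
- exact: cmeasurableB.
- exact: cmeasurableM.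
Qed.

HB.instance Definition _ :=
  GRing.isSubringClosed.Build _ cmfun_pred cmfun_subring_closed.

Record cmfun := CMFun { cmfun_val :> T -> C; _ : cmfun_val \in cmfun_pred }.

HB.instance Definition _ := [isSub for cmfun_val].
HB.instance Definition _ := [Choice of cmfun by <:].
HB.instance Definition _ := [SubChoice_isSubComNzRing of cmfun by <:].

Lemma cmfunP (f : cmfun) : cmeasurable f.
Proof. by have := valP f; rewrite inE. Qed.

Definition mkcmfun (f : T -> C) (mf : cmeasurable f) : cmfun :=
  CMFun (mem_set mf).

Definition null_pred : {pred cmfun} :=
  mem [set f : cmfun | {ae circle_measure, forall x, f x = 0}].

Lemma null_idealr_closed : idealr_closed null_pred.
Proof.
split=> [||a f g]; rewrite ?inE /=.
- exact: aeW.
- apply/negP; rewrite inE /= => h.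
  have E : ~` [set x : T | (1 : cmfun) x = 0] = setT.
    by apply/seteqP; split => // x _ /= /eqP; rewrite oner_eq0.
  have := measure_negligible _ h; rewrite E => /(_ measurableT).
  by rewrite [LHS]circle_measureT => /eqP; rewrite onee_eq0.
- move=> f0 g0; apply: filterS2 f0 g0 => x /= fx gx.
  by rewrite !fctE fx gx mulr0 addr0.
Qed.

HB.instance Definition _ := isIdealr.Build _ null_pred null_idealr_closed.

(* The ring of measurable functions T -> C, two functions being identified when
   they are equal almost everywhere; elements of C are the constants [cstL]. *)
Definition L0 : Type := {ideal_quot null_pred}.
HB.instance Definition _ := NzRingQuotient.on L0.
HB.instance Definition _ := GRing.ComNzRing.on L0.

Definition classL (f : T -> C) (mf : cmeasurable f) : L0 :=
  \pi_L0 (mkcmfun mf).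

Definition reprL (f : L0) : T -> C := repr f : cmfun.

Lemma classL_eqP (f g : T -> C) (mf : cmeasurable f) (mg : cmeasurable g) :
  classL mf = classL mg <-> {ae circle_measure, forall x, f x = g x}.
Proof.
split=> [/eqP|fg].
  rewrite /classL -Quotient.idealrBE inE /= => fg.
  by apply: filterS fg => x /= /eqP; rewrite subr_eq0 => /eqP.
apply/eqP; rewrite /classL -Quotient.idealrBE inE /=.
by apply: filterS fg => x /= fgx; rewrite !fctE fgx subrr.
Qed.

Lemma reprL_class (f : T -> C) (mf : cmeasurable f) :
  {ae circle_measure, forall x, reprL (classL mf) x = f x}.
Proof.
have /eqP : \pi_L0 (repr (classL mf)) = \pi_L0 (mkcmfun mf) by rewrite reprK.
rewrite -Quotient.idealrBE inE /= => h.
by apply: filterS h => x /= /eqP; rewrite subr_eq0 => /eqP.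
Qed.

Lemma cmeasurable_reprL (f : L0) : cmeasurable (reprL f).
Proof. exact: cmfunP. Qed.

Definition cstL (c : C) : L0 := classL (cmeasurable_cst c).

Definition zL : L0 := classL cmeasurable_cval.

Definition conjL (f : L0) : L0 :=
  classL (cmeasurable_conj (cmeasurable_reprL f)).

Definition divL (f g : L0) : L0 :=
  classL (cmeasurableM (cmeasurable_reprL f)
                       (cmeasurableV (cmeasurable_reprL g))).

Definition integralL (f : L0) : C :=
  Rintegral circle_measure setT (fun x => Re (reprL f x)) +i*
  Rintegral circle_measure setT (fun x => Im (reprL f x)).

End ComplexMeasurable.

Arguments zL {R}.

Section Hardy.
Variable R : realType.
Local Notation C := R[i].
Local Notation L0 := (L0 R).
Implicit Types (f g theta alpha : L0) (A B H : set L0).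

Definition L2 : set L0 :=
  [set f | (\int[circle_measure]_x (Re `|reprL f x| ^+ 2)%:E < +oo)%E].

Definition Linfty : set L0 :=
  [set f | exists M : C, {ae circle_measure, forall x, `|reprL f x| <= M}].

Definition innerprod f g : C := integralL (f * conjL g).

(* The Hardy spaces are identified with the spaces of their boundary functions,
   i.e., of the functions whose Fourier coefficients of negative index vanish;
   integralL (f * zL ^+ n.+1) is the coefficient of index - (n + 1) of f. *)
Definition H2 : set L0 :=
  [set f | L2 f /\ forall n, integralL (f * zL ^+ n.+1) = 0].

Definition Hinfty : set L0 :=
  [set f | Linfty f /\ forall n, integralL (f * zL ^+ n.+1) = 0].

Definition inner_function theta : Prop :=
  Hinfty theta /\
  {ae circle_measure, forall x, `|reprL theta x| = 1}.

Definition constantL f : Prop := exists c : C, f = cstL c.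

Definition inner_le alpha theta : Prop := inner_function (divL theta alpha).

Definition orthominus A B : set L0 :=
  [set f | A f /\ forall g, B g -> innerprod f g = 0].

Definition mulop (phi f : L0) : L0 := phi * f.

Definition model_space theta : set L0 :=
  orthominus H2 (mulop theta @` H2).

(* J is a conjugation on the closed subspace H of L2; its values outside H are
   irrelevant. *)
Definition conjugation_on H (J : L0 -> L0) : Prop :=
  [/\ forall f, H f -> H (J f),
      forall (a b : C) f g, H f -> H g ->
        J (cstL a * f + cstL b * g) =
        cstL (conjc a) * J f + cstL (conjc b) * J g,
      forall f, H f -> J (J f) = f &
      forall f g, H f -> H g -> innerprod (J f) (J g) = innerprod g f].

Definition C_ theta f : L0 := theta * conjL zL * conjL f.

End Hardy.

Arguments L2 {R}.

(* Main.v *)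
Require Import Defs.
From HB Require Import structures.
From mathcomp Require Import all_boot all_order all_algebra.
From mathcomp Require Import generic_quotient.
From mathcomp Require Import all_classical all_reals all_analysis.
From mathcomp Require Import measurable_realfun complex.
From mathcomp Require Import ring lra.

(* A conjugation J of L2 with M_z J = J M_zbar has the form J f = psi * conj f with
   psi unimodular, because J o conj commutes with M_z. So Ct acts as psi1 * conj f on
   K_alpha and as psi2 * conj f on alpha K_beta, where theta = alpha * beta. For f in
   K_alpha, split Ct f = g1 + alpha F along this decomposition; the equality
   Ct (Ct f) = f becomes (psi2 - psi1) * conj (alpha F) = 0. A nonzero function of H2
   is nonzero almost everywhere on the circle, so either psi1 = psi2, or Ct preserves
   K_alpha and hence alpha K_beta.

   If theta is not constant and f |-> psi * conj f preserves K_theta, then psi is a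
   constant times theta * zbar: multiplication by u = psi * conj theta * z and by
   conj u preserves K_theta, so it maps the kernel k = 1 - conj (theta(0)) theta into
   H2. Since |theta(0)| < 1, dividing by k gives u and conj u in H2, so u is constant.
   Applying this to theta, or to alpha and beta, proves the theorem. *)

Set Implicit Arguments.
Unset Strict Implicit.
Unset Printing Implicit Defensive.

Import Order.TTheory GRing.Theory Num.Theory.
Import numFieldNormedType.Exports.
Import ComplexField.Normc.

Local Open Scope classical_set_scope.
Local Open Scope ring_scope.
Local Open Scope complex_scope.
Local Open Scope quotient_scope.

Local Notation Re := complex.Re.
Local Notation Im := complex.Im.

(** * Almost everywhere classes and integrals *)

(** Functions are classes on the circle with prescribed vanishing Fourier coefficients, and no
    extension to the disc is used. The value at the origin is therefore the mean, and its
    multiplicativity on H2 is a density statement. The uniqueness of boundary values is drawn from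
    this multiplicativity alone: if g vanishes on E, test it against bounded analytic functions that
    have a large mean but are large essentially only on E. This argument, and the fact that a
    conjugation is determined by its effect on the powers of z, both rest on one tool: the indicator
    of any measurable set is approximated by trigonometric polynomials with values in [0, 1], in an
    L^1 norm weighted by the function at hand. The splitting of K_theta needs the projection onto
    H2, which comes from the completeness of L^2. One degenerate case escapes the kernel argument:
    beta may be constant, and then K_beta is zero and any unimodular constant serves on it. *)

Section Classes.
Variable R : realType.
Local Notation C := R[i].
Local Notation T := (circle R).
Local Notation L0 := (L0 R).
Implicit Types (f g h : L0) (F G : T -> C).

Lemma reprLK f : classL (cmeasurable_reprL f) = f.
Proof.
rewrite -[RHS]reprK /classL; congr (\pi _).
by apply: val_inj.
Qed.

Lemma classL_ind (P : L0 -> Prop) :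
  (forall F (mF : cmeasurable F), P (classL mF)) -> forall f, P f.
Proof. by move=> h f; rewrite -(reprLK f). Qed.

Lemma L0_eqP f g :
  f = g <-> {ae @circle_measure R, forall x, reprL f x = reprL g x}.
Proof.
by rewrite -{1}(reprLK f) -{1}(reprLK g) classL_eqP.
Qed.

Lemma cmeasurableD F G : cmeasurable F -> cmeasurable G -> cmeasurable (F + G).
Proof.
move=> mF mG.
have -> : F + G = F - ((fun=> 0) - G).
  by apply/funext => x; rewrite !fctE /= sub0r opprK.
by apply: cmeasurableB => //; apply: cmeasurableB => //; exact: cmeasurable_cst.
Qed.

Lemma classLD F G (mF : cmeasurable F) (mG : cmeasurable G) :
  classL mF + classL mG = classL (cmeasurableD mF mG).
Proof.
rewrite /classL -[LHS]rmorphD; congr (\pi _); exact: val_inj.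
Qed.

Lemma classLM F G (mF : cmeasurable F) (mG : cmeasurable G) :
  classL mF * classL mG = classL (cmeasurableM mF mG).
Proof.
rewrite /classL -[LHS]rmorphM; congr (\pi _); exact: val_inj.
Qed.

Lemma classLB F G (mF : cmeasurable F) (mG : cmeasurable G) :
  classL mF - classL mG = classL (cmeasurableB mF mG).
Proof.
rewrite /classL -[LHS]rmorphB; congr (\pi _); exact: val_inj.
Qed.

Lemma classL_conj F (mF : cmeasurable F) :
  conjL (classL mF) = classL (cmeasurable_conj mF).
Proof.
by apply/classL_eqP; apply: filterS (reprL_class mF) => x /= ->.
Qed.

Lemma cstLE1 : cstL 1 = 1 :> L0.
Proof.
rewrite -[LHS]mulr1 -[in RHS](reprLK 1) -[in LHS](reprLK 1) classLM.
by apply/classL_eqP/aeW => x /=; rewrite !fctE mul1r.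
Qed.

Lemma cstLB : {morph (@cstL R) : a b / a - b}.
Proof. by move=> a b; rewrite /cstL classLB; exact/classL_eqP/aeW. Qed.

Lemma cstLM : {morph (@cstL R) : a b / a * b}.
Proof. by move=> a b; rewrite /cstL classLM; exact/classL_eqP/aeW. Qed.

HB.instance Definition _ := GRing.isZmodMorphism.Build C L0 (@cstL R) cstLB.
HB.instance Definition _ :=
  GRing.isMonoidMorphism.Build C L0 (@cstL R) (cstLE1, cstLM).

Lemma conjLB : {morph (@conjL R) : f g / f - g}.
Proof.
elim/classL_ind => F mF; elim/classL_ind => G mG.
rewrite classLB !classL_conj classLB; apply/classL_eqP/aeW => x /=.
by rewrite !fctE rmorphB.
Qed.

Lemma conjLM : {morph (@conjL R) : f g / f * g}.
Proof.
elim/classL_ind => F mF; elim/classL_ind => G mG.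
rewrite classLM !classL_conj classLM; apply/classL_eqP/aeW => x /=.
by rewrite !fctE rmorphM.
Qed.

Lemma conjL_cst (c : C) : conjL (cstL c) = cstL (conjc c) :> L0.
Proof. by rewrite classL_conj; exact/classL_eqP/aeW. Qed.

Lemma conjL1 : conjL 1 = 1 :> L0.
Proof. by rewrite -cstLE1 conjL_cst rmorph1. Qed.

HB.instance Definition _ := GRing.isZmodMorphism.Build L0 L0 (@conjL R) conjLB.
HB.instance Definition _ :=
  GRing.isMonoidMorphism.Build L0 L0 (@conjL R) (conjL1, conjLM).

Lemma conjLK : involutive (@conjL R).
Proof.
elim/classL_ind => F mF; rewrite !classL_conj.
by apply/classL_eqP/aeW => x /=; rewrite conjcK.
Qed.

Lemma normc_eq1 (z : C) : (`|z| = 1) <-> z * conjc z = 1.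
Proof.
rewrite -sqr_normc; split=> [->|/eqP]; first by rewrite expr1n.
by rewrite pexpr_eq1// => /eqP.
Qed.

(** An identity in the ring of classes, so that cancelling such a factor is algebra and not an
    almost everywhere argument. *)
Definition unimodular f := f * conjL f = 1.

Lemma unimodularP f :
  unimodular f <-> {ae @circle_measure R, forall x, `|reprL f x| = 1}.
Proof.
rewrite /unimodular -{1 2}(reprLK f) classL_conj classLM -cstLE1 classL_eqP.
split; apply: filterS => x; rewrite /= !fctE.
  exact: (normc_eq1 _).2.
exact: (normc_eq1 _).1.
Qed.

Lemma unimodular_z : unimodular (@zL R).
Proof.
rewrite /unimodular /zL classL_conj classLM -cstLE1; apply/classL_eqP/aeW => x /=.
by rewrite !fctE; apply/normc_eq1/eqP/cvalP.
Qed.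

Lemma unimodular_conj f : unimodular f -> unimodular (conjL f).
Proof. by rewrite /unimodular conjLK mulrC. Qed.

Lemma unimodularM f g : unimodular f -> unimodular g -> unimodular (f * g).
Proof.
by rewrite /unimodular rmorphM mulrACA => -> ->; rewrite mulr1.
Qed.

Lemma unimodularX f n : unimodular f -> unimodular (f ^+ n).
Proof. by rewrite /unimodular rmorphXn/= -exprMn => ->; rewrite expr1n. Qed.

Lemma divLE f g : unimodular g -> divL f g = f * conjL g.
Proof.
move=> /unimodularP ug; rewrite -[in RHS](reprLK f) -[in RHS](reprLK g).
rewrite classL_conj classLM /divL; apply/classL_eqP.
by apply: filterS ug => x /= gx; rewrite !fctE invc_norm gx expr1n invr1 mul1r.
Qed.

Lemma classL_mulcst (c : C) F (mF : cmeasurable F) :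
  cstL c * classL mF = classL (cmeasurableM (cmeasurable_cst c) mF).
Proof. exact: classLM. Qed.

Lemma reprLM f g :
  {ae @circle_measure R, forall x, reprL (f * g) x = reprL f x * reprL g x}.
Proof.
have := classLM (cmeasurable_reprL f) (cmeasurable_reprL g).
rewrite !reprLK => /L0_eqP; apply: filterS2 (reprL_class (cmeasurableM
  (cmeasurable_reprL f) (cmeasurable_reprL g))) => x /= -> -> //.
Qed.

End Classes.

(** * Integrable real functions on the circle, and the L^1 and L^2 sizes of a class *)

Section Integrals.
Variable R : realType.
Local Notation C := R[i].
Local Notation T := (circle R).
Local Notation L0 := (L0 R).
Local Notation mu := (@circle_measure R).
Implicit Types (f g h : L0) (F G : T -> C) (u v : T -> R).

Definition rintegrable u := mu.-integrable setT (EFin \o u).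
Definition rint u : R := Rintegral mu setT u.

Lemma rintegrable_measurable u : rintegrable u -> measurable_fun setT u.
Proof. by move=> /integrableP[/measurable_EFinP]. Qed.

Lemma rintegrable_le u v : measurable_fun setT u ->
  (forall x, `|u x| <= v x) -> rintegrable v -> rintegrable u.
Proof.
move=> mu_ uv iv; apply: (le_integrable _ _ _ iv) => //.
  exact/measurable_EFinP.
by move=> x _ /=; rewrite lee_fin (le_trans (uv x))// ler_norm.
Qed.

Lemma rintegrable_cst c : rintegrable (fun=> c).
Proof.
exact: finite_measure_integrable_cst.
Qed.

Lemma rintegrableD u v :
  rintegrable u -> rintegrable v -> rintegrable (fun x => u x + v x).
Proof. move=> iu iv.
exact: (@integrableD _ _ _ mu setT measurableT (EFin \o u) (EFin \o v)). Qed.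

Lemma rintegrableZ c u : rintegrable u -> rintegrable (fun x => c * u x).
Proof. move=> iu.
exact: (@integrableZl _ _ _ mu setT measurableT c (EFin \o u)). Qed.

Lemma rint_cst c : rint (fun=> c) = c.
Proof.
by rewrite /rint Rintegral_cst// [X in fine X]circle_measureT mulr1.
Qed.

Lemma rintD u v : rintegrable u -> rintegrable v ->
  rint (fun x => u x + v x) = rint u + rint v.
Proof. by move=> iu iv; exact: RintegralD. Qed.

Lemma rintZ c u : rintegrable u -> rint (fun x => c * u x) = c * rint u.
Proof. by move=> iu; exact: RintegralZl. Qed.

Lemma rint_le u v : rintegrable u -> rintegrable v ->
  (forall x, u x <= v x) -> rint u <= rint v.
Proof. by move=> iu iv uv; apply: le_Rintegral => // x _; exact: uv. Qed.

Lemma rint_ge0 u : (forall x, 0 <= u x) -> 0 <= rint u.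
Proof. by move=> u0; apply: Rintegral_ge0 => x _; exact: u0. Qed.

Lemma rint_ae u v : measurable_fun setT u -> measurable_fun setT v ->
  {ae mu, forall x, u x = v x} -> rint u = rint v.
Proof.
move=> mu_ mv uv; congr fine; apply: ae_eq_integral => //;
  [exact/measurable_EFinP..|].
by apply: filterS uv => x /= ->.
Qed.

Lemma rintegrable_ae u v : measurable_fun setT u -> measurable_fun setT v ->
  {ae mu, forall x, u x = v x} -> rintegrable u -> rintegrable v.
Proof.
move=> mu_ mv uv /integrableP[_ iu]; apply/integrableP; split.
  exact/measurable_EFinP.
apply: le_lt_trans iu; apply: ae_ge0_le_integral => //.
- by do 2 apply: measurableT_comp => //; exact/measurable_EFinP.
- by do 2 apply: measurableT_comp => //; exact/measurable_EFinP.
by apply: filterS uv => x /= ->.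
Qed.

Lemma ge0_rintegrableP u : measurable_fun setT u -> (forall x, 0 <= u x) ->
  rintegrable u <-> (\int[mu]_x (u x)%:E < +oo)%E.
Proof.
move=> mu_ u0; split=> [/integrable_lty|iu]; first exact.
apply/integrableP; split; first exact/measurable_EFinP.
apply: le_lt_trans iu; rewrite le_eqVlt; apply/orP; left; apply/eqP.
by apply: eq_integral => x _ /=; rewrite ger0_norm.
Qed.

Lemma normc_ge0 (z : C) : 0 <= normc z.
Proof. by case: z => a b /=; rewrite sqrtr_ge0. Qed.

Lemma sqr_normcE (z : C) : normc z ^+ 2 = Re z ^+ 2 + Im z ^+ 2.
Proof. by case: z => a b /=; rewrite sqr_sqrtr// addr_ge0 ?sqr_ge0. Qed.

Lemma Re_le_normc (z : C) : `|Re z| <= normc z.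
Proof.
rewrite -(@ler_pXn2r _ 2)// ?nnegrE ?normc_ge0// real_normK ?num_real//.
by rewrite sqr_normcE lerDl sqr_ge0.
Qed.

Lemma Im_le_normc (z : C) : `|Im z| <= normc z.
Proof.
rewrite -(@ler_pXn2r _ 2)// ?nnegrE ?normc_ge0// real_normK ?num_real//.
by rewrite sqr_normcE lerDr sqr_ge0.
Qed.

Lemma normc_conjc (z : C) : normc (conjc z) = normc z.
Proof. by case: z => a b /=; rewrite sqrrN. Qed.

Lemma measurable_normc F :
  cmeasurable F -> measurable_fun setT (fun x => normc (F x)).
Proof.
move=> [mr mi].
have -> : (fun x => normc (F x)) =
    (fun x => (Re (F x) ^+ 2 + Im (F x) ^+ 2) `^ 2^-1).
  apply/funext => x; rewrite -sqr_normcE powR12_sqrt ?sqr_ge0//.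
  by rewrite sqrtr_sqr ger0_norm// normc_ge0.
apply: (measurableT_comp (measurable_powR _)) => //.
by apply: measurable_funD; exact: measurable_funX.
Qed.

Lemma measurable_normc2 F :
  cmeasurable F -> measurable_fun setT (fun x => normc (F x) ^+ 2).
Proof. by move=> mF; apply: measurable_funX; exact: measurable_normc. Qed.

Definition L1 : set L0 :=
  [set f | rintegrable (fun x => normc (reprL f x))].

Definition N1 f := rint (fun x => normc (reprL f x)).
(** The squared L^2 norm. It is never rooted: all estimates below are between squares. *)
Definition N2 f := rint (fun x => normc (reprL f x) ^+ 2).

Lemma L1_class F (mF : cmeasurable F) :
  L1 (classL mF) <-> rintegrable (fun x => normc (F x)).
Proof.
have E := reprL_class mF.
have m1 := measurable_normc (cmeasurable_reprL (classL mF)).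
have m2 := measurable_normc mF.
by split; apply: rintegrable_ae => //; apply: filterS E => x /= ->.
Qed.

Lemma L2_class F (mF : cmeasurable F) :
  L2 (classL mF) <-> rintegrable (fun x => normc (F x) ^+ 2).
Proof.
have E := reprL_class mF.
have m1 := measurable_normc2 (cmeasurable_reprL (classL mF)).
have m2 := measurable_normc2 mF.
have nn G x : 0 <= normc (G x : C) ^+ 2 by rewrite sqr_ge0.
split=> h.
  apply: (rintegrable_ae m1 m2); first by apply: filterS E => x /= ->.
  exact/(ge0_rintegrableP m1 (nn _)).
apply/(ge0_rintegrableP m1 (nn _)).
by apply: rintegrable_ae h => //; apply: filterS E => x /= ->.
Qed.

Lemma N1_class F (mF : cmeasurable F) :
  N1 (classL mF) = rint (fun x => normc (F x)).
Proof.
apply: rint_ae; [exact: measurable_normc (cmeasurable_reprL _)|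
  exact: measurable_normc|].
by apply: filterS (reprL_class mF) => x /= ->.
Qed.

Lemma N2_class F (mF : cmeasurable F) :
  N2 (classL mF) = rint (fun x => normc (F x) ^+ 2).
Proof.
apply: rint_ae; [exact: measurable_normc2 (cmeasurable_reprL _)|
  exact: measurable_normc2|].
by apply: filterS (reprL_class mF) => x /= ->.
Qed.

Lemma integralL_class F (mF : cmeasurable F) :
  integralL (classL mF) =
  rint (fun x => Re (F x)) +i* rint (fun x => Im (F x)).
Proof.
have [m1 m2] := cmeasurable_reprL (classL mF); have [m3 m4] := mF.
by congr (_ +i* _); apply: rint_ae => //;
  apply: filterS (reprL_class mF) => x /= ->.
Qed.

End Integrals.

(** * The spaces L^1, L^2 and L^infinity, and linearity of the integral *)

Section Spaces.
Variable R : realType.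
Local Notation C := R[i].
Local Notation T := (circle R).
Local Notation L0 := (L0 R).
Local Notation mu := (@circle_measure R).
Implicit Types (f g h : L0) (F G : T -> C) (u v : T -> R).

Lemma L1D f g : L1 f -> L1 g -> L1 (f + g).
Proof.
elim/classL_ind: f => F mF; elim/classL_ind: g => G mG.
rewrite classLD => /L1_class iF /L1_class iG; apply/L1_class.
apply: rintegrable_le (rintegrableD iF iG).
  exact: measurable_normc (cmeasurableD _ _).
by move=> x; rewrite ger0_norm ?normc_ge0// le_normcD.
Qed.

Lemma L2_conj f : L2 f -> L2 (conjL f).
Proof.
elim/classL_ind: f => F mF; rewrite classL_conj => /L2_class iF.
by apply/L2_class; under eq_fun do rewrite normc_conjc.
Qed.

Lemma N2_conj f : N2 (conjL f) = N2 f.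
Proof.
elim/classL_ind: f => F mF; rewrite classL_conj !N2_class.
by under eq_fun do rewrite normc_conjc.
Qed.

Lemma L2M f g : L2 f -> L2 g -> L1 (f * g).
Proof.
elim/classL_ind: f => F mF; elim/classL_ind: g => G mG.
rewrite classLM => /L2_class iF /L2_class iG; apply/L1_class.
apply: rintegrable_le (rintegrableD iF iG).
  exact: measurable_normc (cmeasurableM _ _).
move=> x; rewrite !fctE ger0_norm ?normc_ge0// normcM.
have := sqr_ge0 (normc (F x) - normc (G x)).
have := mulr_ge0 (normc_ge0 (F x)) (normc_ge0 (G x)); nra.
Qed.

(* The weighted arithmetic-geometric mean inequality replaces Cauchy-Schwarz. *)
Lemma N1M_le f g (t : R) : 0 < t -> L2 f -> L2 g ->
  N1 (f * g) <= t * N2 f + t^-1 * N2 g.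
Proof.
move=> t0; elim/classL_ind: f => F mF; elim/classL_ind: g => G mG.
move=> /[dup] lF /L2_class iF /[dup] lG /L2_class iG.
have /= := L2M lF lG; rewrite classLM N1_class !N2_class => /L1_class i.
rewrite -!rintZ// -rintD; [|exact: rintegrableZ..].
apply: rint_le => //; first by apply: rintegrableD; exact: rintegrableZ.
move=> x; rewrite !fctE normcM.
have a0 := normc_ge0 (F x); have b0 := normc_ge0 (G x).
move: a0 b0; set a := normc _; set b := normc _ => a0 b0.
have := sqr_ge0 (t * a - b); have := mulr_ge0 a0 b0.
have tV : t * t^-1 = 1 by rewrite divff// gt_eqF.
have := invr_gt0 t; rewrite t0; set s := t^-1 in tV *.
move=> s0 ab sq; have : 0 <= s * (t * a - b) ^+ 2 by rewrite mulr_ge0// ltW.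
have -> : s * (t * a - b) ^+ 2 =
  (t * s) * t * a ^+ 2 - 2 * (t * s) * (a * b) + s * b ^+ 2 by ring.
by rewrite tV; lra.
Qed.

Lemma L2D f g : L2 f -> L2 g -> L2 (f + g).
Proof.
elim/classL_ind: f => F mF; elim/classL_ind: g => G mG.
rewrite classLD => /L2_class iF /L2_class iG; apply/L2_class.
apply: rintegrable_le (rintegrableZ 2 (rintegrableD iF iG)).
  exact: measurable_normc2 (cmeasurableD _ _).
move=> x; rewrite !fctE ger0_norm ?sqr_ge0//.
have := le_normcD (F x) (G x); have := normc_ge0 (F x + G x).
have := sqr_ge0 (normc (F x) - normc (G x)); nra.
Qed.

Lemma N2_ge0 f : 0 <= N2 f.
Proof. by apply: rint_ge0 => x; rewrite sqr_ge0. Qed.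

Lemma N1_ge0 f : 0 <= N1 f.
Proof. by apply: rint_ge0 => x; rewrite normc_ge0. Qed.

(** With a bound valid everywhere, domination arguments need no null sets. The representative is
    replaced by 0 where its modulus exceeds the bound; [M] is complex, and the order of the complex
    numbers only compares the modulus with its real part. *)
Lemma Linfty_repr f : Linfty f ->
  exists F (mF : cmeasurable F) (M : R),
    f = classL mF /\ forall x, normc (F x) <= M.
Proof.
move=> [M bf].
have mf := cmeasurable_reprL f.
pose G x := if normc (reprL f x) <= Re M then reprL f x else 0.
have mG : cmeasurable G.
  have mb : measurable_fun setT (fun x => normc (reprL f x) <= Re M).
    by apply: measurable_fun_ler => //; exact: measurable_normc.
  split; rewrite /G.
    have -> : (fun x => Re (if normc (reprL f x) <= Re M then reprL f x else 0))
      = fun x => if normc (reprL f x) <= Re M then Re (reprL f x) else 0.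
      by apply/funext => x; case: ifP.
    by apply: measurable_fun_ifT => //; case: mf.
  have -> : (fun x => Im (if normc (reprL f x) <= Re M then reprL f x else 0))
    = fun x => if normc (reprL f x) <= Re M then Im (reprL f x) else 0.
    by apply/funext => x; case: ifP.
  by apply: measurable_fun_ifT => //; case: mf.
exists G, mG, `|Re M|; split.
  rewrite -[LHS]reprLK; apply/classL_eqP; apply: filterS bf => x.
  by rewrite /G lecE => /andP[_ /= ->].
move=> x; rewrite /G; case: ifP => [h|_]; last by rewrite normc0.
exact: le_trans h (ler_norm _).
Qed.

Lemma LinftyL1 f g : Linfty f -> L1 g -> L1 (f * g).
Proof.
move=> /Linfty_repr[F [mF [M [-> bF]]]]; elim/classL_ind: g => G mG.
rewrite classLM => /L1_class iG; apply/L1_class.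
apply: rintegrable_le (rintegrableZ M iG).
  exact: measurable_normc (cmeasurableM _ _).
move=> x; rewrite !fctE ger0_norm ?normc_ge0// normcM.
by rewrite ler_wpM2r// normc_ge0.
Qed.

Lemma LinftyL2 f g : Linfty f -> L2 g -> L2 (f * g).
Proof.
move=> /Linfty_repr[F [mF [M [-> bF]]]]; elim/classL_ind: g => G mG.
rewrite classLM => /L2_class iG; apply/L2_class.
apply: rintegrable_le (rintegrableZ (M ^+ 2) iG).
  exact: measurable_normc2 (cmeasurableM _ _).
move=> x; rewrite !fctE ger0_norm ?sqr_ge0// normcM exprMn.
rewrite ler_wpM2r ?sqr_ge0// ler_pXn2r// ?nnegrE ?normc_ge0//.
exact: le_trans (normc_ge0 _) (bF x).
Qed.

Lemma Linfty_class F (mF : cmeasurable F) (M : R) :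
  (forall x, normc (F x) <= M) -> Linfty (classL mF).
Proof.
move=> bF; exists M%:C; apply: filterS (reprL_class mF) => x /= ->.
by rewrite lecR.
Qed.

Lemma LinftyM f g : Linfty f -> Linfty g -> Linfty (f * g).
Proof.
move=> /Linfty_repr[F [mF [M [-> bF]]]] /Linfty_repr[G [mG [N [-> bG]]]].
rewrite classLM; apply: (@Linfty_class _ _ (M * N)) => x.
by rewrite !fctE normcM ler_pM ?normc_ge0.
Qed.

Lemma LinftyD f g : Linfty f -> Linfty g -> Linfty (f + g).
Proof.
move=> /Linfty_repr[F [mF [M [-> bF]]]] /Linfty_repr[G [mG [N [-> bG]]]].
rewrite classLD; apply: (@Linfty_class _ _ (M + N)) => x.
by rewrite !fctE (le_trans (le_normcD _ _))// lerD.
Qed.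

Lemma Linfty_cst (c : C) : Linfty (cstL c).
Proof. exact: (@Linfty_class _ _ (normc c)). Qed.

Lemma L2_1 : L2 (1 : L0).
Proof.
rewrite -cstLE1; apply/L2_class; exact: rintegrable_cst.
Qed.

Lemma Linfty_L2 f : Linfty f -> L2 f.
Proof. by move=> bf; rewrite -[f]mulr1; apply: LinftyL2 L2_1. Qed.

Lemma L2_L1 f : L2 f -> L1 f.
Proof. by move=> lf; rewrite -[f]mulr1; apply: L2M L2_1. Qed.

Lemma unimodular_Linfty f : unimodular f -> Linfty f.
Proof.
by move=> /unimodularP uf; exists 1; apply: filterS uf => x /= ->.
Qed.

Lemma L2Z c f : L2 f -> L2 (cstL c * f).
Proof. exact/LinftyL2/Linfty_cst. Qed.

Lemma L2N f : L2 f -> L2 (- f).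
Proof.
by move=> lf; rewrite -mulN1r -cstLE1 -rmorphN/=; exact: L2Z.
Qed.

Lemma L2B f g : L2 f -> L2 g -> L2 (f - g).
Proof. by move=> lf /L2N; exact: L2D. Qed.

Lemma L1Z c f : L1 f -> L1 (cstL c * f).
Proof. exact/LinftyL1/Linfty_cst. Qed.

Lemma L1N f : L1 f -> L1 (- f).
Proof.
by move=> lf; rewrite -mulN1r -cstLE1 -rmorphN/=; exact: L1Z.
Qed.

Lemma L1B f g : L1 f -> L1 g -> L1 (f - g).
Proof. by move=> lf /L1N; exact: L1D. Qed.

Lemma L2_umul f g : unimodular f -> L2 g -> L2 (f * g).
Proof. by move=> /unimodular_Linfty; exact: LinftyL2. Qed.

Lemma L1_umul f g : unimodular f -> L1 g -> L1 (f * g).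
Proof. by move=> /unimodular_Linfty; exact: LinftyL1. Qed.

Lemma N1_umul f g : unimodular f -> N1 (f * g) = N1 g.
Proof.
move=> /unimodularP uf; apply: rint_ae;
  [exact: measurable_normc (cmeasurable_reprL _)..|].
apply: filterS2 uf (reprLM f g) => x /= fx ->.
by rewrite normcM; case: fx => ->; rewrite mul1r.
Qed.

Lemma N2_umul f g : unimodular f -> N2 (f * g) = N2 g.
Proof.
move=> /unimodularP uf; apply: rint_ae;
  [exact: measurable_normc2 (cmeasurable_reprL _)..|].
apply: filterS2 uf (reprLM f g) => x /= fx ->.
by rewrite normcM; case: fx => ->; rewrite mul1r.
Qed.

Lemma N2_eq0 f : L2 f -> N2 f = 0 -> f = 0.
Proof.
elim/classL_ind: f => F mF /L2_class iF; rewrite N2_class => F0.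
have -> : 0 = cstL 0 :> L0 by rewrite rmorph0.
apply/classL_eqP.
have : (\int[mu]_x `|(normc (F x) ^+ 2)%:E| = 0)%E.
  have h := integrable_fin_num measurableT iF.
  transitivity (rint (fun x => normc (F x) ^+ 2))%:E; last by rewrite F0.
  rewrite /rint /Rintegral fineK//.
  apply: eq_integral => x _ /=.
  by rewrite ger0_norm// sqr_ge0.
have mm : measurable_fun setT (EFin \o (fun x => normc (F x) ^+ 2)).
  by apply/measurable_EFinP; exact: measurable_normc2.
move/(ae_eq_integral_abs mu measurableT mm); apply: filterS => x /= /(_ I)[].
by move=> /eqP; rewrite sqrf_eq0 => /eqP/eq0_normc.
Qed.

Lemma rintegrable_Re F : cmeasurable F ->
  rintegrable (fun x => normc (F x)) -> rintegrable (fun x => Re (F x)).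
Proof. by case=> mF _; apply: rintegrable_le => // x; exact: Re_le_normc. Qed.

Lemma rintegrable_Im F : cmeasurable F ->
  rintegrable (fun x => normc (F x)) -> rintegrable (fun x => Im (F x)).
Proof. by case=> _ mF; apply: rintegrable_le => // x; exact: Im_le_normc. Qed.

Lemma integralLD f g : L1 f -> L1 g ->
  integralL (f + g) = integralL f + integralL g.
Proof.
elim/classL_ind: f => F mF; elim/classL_ind: g => G mG.
rewrite classLD !integralL_class => /L1_class iF /L1_class iG.
have h (z w : C) : (Re z + Re w) +i* (Im z + Im w) = z + w.
  by case: z => a b; case: w.
have := (rintegrable_Re mF iF, rintegrable_Im mF iF).
have := (rintegrable_Re mG iG, rintegrable_Im mG iG) => -[? ?] [? ?].
rewrite -[RHS]h /= -!rintD//.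
by congr (_ +i* _); congr rint; apply/funext => x; rewrite !fctE;
  case: (F x) => a b; case: (G x).
Qed.

Lemma integralLZ c f : L1 f -> integralL (cstL c * f) = c * integralL f.
Proof.
elim/classL_ind: f => F mF.
rewrite classL_mulcst !integralL_class => /L1_class iF.
have iR := rintegrable_Re mF iF; have iI := rintegrable_Im mF iF.
case: c => a b; rewrite [RHS]/GRing.mul /=; congr (_ +i* _).
  rewrite -mulNr -!rintZ// -rintD; [|exact: rintegrableZ..].
  by congr rint; apply/funext => x; rewrite !fctE Defs.ReM /= mulNr.
rewrite -!rintZ// -rintD; [|exact: rintegrableZ..].
by congr rint; apply/funext => x; rewrite !fctE Defs.ImM /= addrC.
Qed.

Lemma integralLN f : L1 f -> integralL (- f) = - integralL f.
Proof.
by move=> lf; rewrite -mulN1r -cstLE1 -rmorphN/= integralLZ// mulN1r.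
Qed.

Lemma integralLB f g : L1 f -> L1 g ->
  integralL (f - g) = integralL f - integralL g.
Proof.
by move=> lf lg; rewrite integralLD ?integralLN//; exact: L1N.
Qed.

Lemma integralL_conj f : L1 f -> integralL (conjL f) = conjc (integralL f).
Proof.
elim/classL_ind: f => F mF.
rewrite classL_conj !integralL_class => /L1_class iF /=.
have iI := rintegrable_Im mF iF.
congr (_ +i* _); first by congr rint; apply/funext => x; case: (F x).
rewrite -mulN1r -rintZ//.
by congr rint; apply/funext => x; case: (F x) => a b; rewrite mulN1r.
Qed.

Lemma integralL_cst c : integralL (cstL c) = c :> C.
Proof. by rewrite integralL_class !rint_cst; case: c. Qed.

Lemma integralL0 : integralL (0 : L0) = 0.
Proof. by rewrite -(rmorph0 (@cstL R)) integralL_cst. Qed.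

Lemma integralL1 : integralL (1 : L0) = 1.
Proof. by rewrite -cstLE1 integralL_cst. Qed.

Lemma Re_integralL_le f : L1 f -> Re (integralL f) <= N1 f.
Proof.
elim/classL_ind: f => F mF; rewrite integralL_class N1_class => /L1_class iF.
apply: rint_le => //=; first exact: rintegrable_Re.
by move=> x; exact: le_trans (ler_norm _) (Re_le_normc _).
Qed.

Lemma normc_integralL f : L1 f -> normc (integralL f) <= N1 f.
Proof.
move=> lf; set I := integralL f.
have [I0|I0] := eqVneq (normc I) 0; first by rewrite I0 N1_ge0.
(* The rotation that carries the integral to its modulus, which reduces the claim to real parts. *)
pose c : C := conjc I * (normc I)^-1%:C.
have cI : c * I = (normc I)%:C.
  rewrite /c mulrAC [conjc I * I]mulrC -sqr_normc -[`|I|]/(normc I)%:C.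
  by rewrite -!rmorphXn -rmorphM /= expr2 mulfK.
have nc : normc c = 1.
  by rewrite normcM normc_conjc /= expr0n addr0 sqrtr_sqr normfV ger0_norm
    ?normc_ge0// mulfV.
have uc : unimodular (cstL c).
  rewrite /unimodular conjL_cst -rmorphM -cstLE1; congr cstL.
  by apply/normc_eq1; rewrite -[LHS]/(normc c)%:C nc.
have -> : normc I = Re (integralL (cstL c * f)) by rewrite integralLZ// cI.
by rewrite -(N1_umul f uc) Re_integralL_le//; exact: L1_umul.
Qed.

Lemma innerprodff f : L2 f -> innerprod f f = (N2 f)%:C.
Proof.
elim/classL_ind: f => F mF /L2_class iF.
rewrite /innerprod classL_conj classLM integralL_class N2_class.
congr (_ +i* _).
  congr rint; apply/funext => x; rewrite !fctE -sqr_normc -[`|_|]/(normc _)%:C.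
  by rewrite -rmorphXn.
under eq_fun do rewrite !fctE -sqr_normc -[`|_|]/(normc _)%:C -rmorphXn /=.
exact: rint_cst.
Qed.

Lemma N1_unimodular f : unimodular f -> N1 f = 1.
Proof.
move=> uf; rewrite -[f]mulr1 N1_umul// -cstLE1 N1_class.
by rewrite -[RHS]normc1; exact: rint_cst.
Qed.

End Spaces.

(** * Density of trigonometric polynomials *)

Section Density.
Variable R : realType.
Local Notation C := R[i].
Local Notation T := (circle R).
Local Notation mu := (@circle_measure R).
Implicit Types (u v w p q : T -> R) (E F : set T).

Lemma rint_dct0 (u_ : nat -> T -> R) u v :
  (forall n, measurable_fun setT (u_ n)) -> measurable_fun setT u ->
  (forall x, u_ n x @[n --> \oo] --> u x) ->
  (forall n x, `|u_ n x| <= v x) -> rintegrable v ->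
  rint (fun x => `|u_ n x - u x|) @[n --> \oo] --> 0.
Proof.
move=> mu_ mu0 uu uv iv.
have mU n : measurable_fun setT (EFin \o u_ n) by exact/measurable_EFinP.
have mu' : measurable_fun setT (EFin \o u) by exact/measurable_EFinP.
have cU : {ae mu, forall x, setT x ->
    (EFin \o u_ n) x @[n --> \oo] --> (EFin \o u) x}.
  by apply: aeW => x _; apply: cvg_EFin; [exact: nearW|exact: uu].
have dU : {ae mu, forall x n, setT x ->
    (`|(EFin \o u_ n) x| <= (EFin \o v) x)%E}.
  by apply: aeW => x n _ /=; rewrite lee_fin.
have [_ + _] := dominated_convergence measurableT mU mu' cU iv dU.
exact: fine_cvg.
Qed.

(* On the circle, the real polynomials in Re z and Im z are the real trigonometric
   polynomials. *)
Inductive rtrig : (T -> R) -> Prop :=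
| rtrig_cst c : rtrig (fun=> c)
| rtrig_Re : rtrig (fun x => Re (cval x))
| rtrig_Im : rtrig (fun x => Im (cval x))
| rtrigD p q : rtrig p -> rtrig q -> rtrig (fun x => p x + q x)
| rtrigM p q : rtrig p -> rtrig q -> rtrig (fun x => p x * q x).

Lemma measurable_rtrig p : rtrig p -> measurable_fun setT p.
Proof.
elim=> [c|||q r _ mq _ mr|q r _ mq _ mr].
- exact: measurable_cst.
- exact: (@cmeasurable_cval R).1.
- exact: (@cmeasurable_cval R).2.
- exact: measurable_funD.
- exact: measurable_funM.
Qed.

Lemma rtrigX p n : rtrig p -> rtrig (fun x => p x ^+ n).
Proof.
move=> tp; elim: n => [|n ih].
  by under eq_fun do rewrite expr0; exact: rtrig_cst.
by under eq_fun do rewrite exprS; exact: rtrigM.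
Qed.

Lemma rtrigC p : rtrig p -> rtrig (fun x => 1 - p x).
Proof.
move=> tp; have -> : (fun x => 1 - p x) = (fun x => 1 + (-1) * p x).
  by apply/funext => x; rewrite mulN1r.
by apply: rtrigD; [exact: rtrig_cst|apply: rtrigM => //; exact: rtrig_cst].
Qed.

Lemma norm_cval (x : T) : normc (cval x) = 1.
Proof. by have /eqP[] := cvalP x. Qed.

Lemma Re_cval_itv (x : T) : -1 <= Re (cval x) <= 1.
Proof. by rewrite -ler_norml -(norm_cval x) Re_le_normc. Qed.

Lemma Im_cval_itv (x : T) : -1 <= Im (cval x) <= 1.
Proof. by rewrite -ler_norml -(norm_cval x) Im_le_normc. Qed.

End Density.

(** * Polynomials that approximate a step function on [0, 1] *)

Section Threshold.
Variable R : realType.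

Lemma bernoulli_le (h : R) n : -1 <= h -> 1 + n%:R * h <= (1 + h) ^+ n.
Proof.
move=> h1; elim: n => [|n ih]; first by rewrite mul0r addr0 expr0.
have h0 : 0 <= 1 + h by lra.
have := ler_wpM2r h0 ih; rewrite -exprSr; apply: le_trans.
have := mulr_ge0 (ler0n R n) (sqr_ge0 h).
by rewrite -natr1 expr2; lra.
Qed.

(** Write r = s^2. By Bernoulli's inequality for 1/s the product n s^n stays bounded, and one
    geometric factor s^n is left over. *)
Lemma cvg_mulrn_expr (r : R) : 0 <= r < 1 -> n%:R * r ^+ n @[n --> \oo] --> 0.
Proof.
move=> /andP[r0 r1]; set s := Num.sqrt r.
have sE : r = s ^+ 2 by rewrite sqr_sqrtr.
have s0 : 0 <= s by rewrite sqrtr_ge0.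
have s1 : s < 1 by rewrite -sqrtr1 ltr_sqrt.
have d0 : 0 < 1 - s by lra.
have b n : n%:R * s ^+ n <= (1 - s)^-1.
  have [->|sn0] := eqVneq s 0.
    rewrite subr0 invr1; case: n => [|n]; first by rewrite mul0r.
    by rewrite expr0n mulr0.
  have sp : 0 < s by rewrite lt_def sn0.
  have h0 : -1 <= s^-1 - 1 by have := invr_ge0 s; rewrite s0; lra.
  have := bernoulli_le n h0; rewrite [X in X ^+ n]addrC subrK exprVn => h.
  have sn : 0 < s ^+ n by rewrite exprn_gt0.
  have : s ^+ n * (1 + n%:R * (s^-1 - 1)) <= 1.
    by rewrite -[leRHS](divff (lt0r_neq0 sn)) ler_pM2l.
  have -> : s^-1 - 1 = s^-1 * (1 - s) by rewrite mulrBr mulr1 mulVf.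
  move=> h2; have V1 : 1 <= s^-1 by rewrite invf_ge1// ltW.
  have d1 := ltW d0.
  rewrite -[leRHS]mul1r ler_pdivlMr//.
  have : s ^+ n * (n%:R * (1 - s)) <= s ^+ n * (n%:R * (s^-1 * (1 - s))).
    by rewrite ler_pM2l// ler_wpM2l// ler_peMl.
  by move: h2; rewrite mulrDr mulr1; lra.
apply: (@squeeze_cvgr _ _ _ _ (fun=> 0) (fun n => (1 - s)^-1 * s ^+ n)).
- near=> n; rewrite mulr_ge0 ?ler0n ?exprn_ge0//= sE -exprM mulnC exprM.
  by rewrite expr2 mulrA ler_wpM2r// exprn_ge0.
- exact: cvg_cst.
- rewrite -[X in _ --> X](mulr0 (1 - s)^-1); apply: cvgM; first exact: cvg_cst.
  by apply: cvg_expr; rewrite ger0_norm.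
Unshelve. all: by end_near. Qed.

(* The exponent [n * 2 ^ n] makes the value at the threshold [2^-1] tend to 0
   as well, so that the convergence holds at every point of [0, 1]. *)
Lemma threshold_cvg (y : R) : 0 <= y <= 1 ->
  (1 - y ^+ n) ^+ (n * 2 ^ n) @[n --> \oo] --> ((y < 2^-1)%R%:R : R).
Proof.
move=> /andP[y0 y1].
have yn n : 0 <= y ^+ n <= 1 by rewrite exprn_ge0// exprn_ile1.
have v0 n : 0 <= (1 - y ^+ n) ^+ (n * 2 ^ n).
  by rewrite exprn_ge0// subr_ge0; case/andP: (yn n).
have v1 n : (1 - y ^+ n) ^+ (n * 2 ^ n) <= 1.
  by have /andP[? ?] := yn n; rewrite exprn_ile1 ?subr_ge0 ?gerBl.
have [y2|y2] := ltP y 2^-1.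
  apply: (@squeeze_cvgr _ _ _ _ (fun n => 1 - n%:R * (2 * y) ^+ n) (fun=> 1)).
  - near=> n; rewrite v1 andbT.
    have h : -1 <= - y ^+ n by rewrite lerN2; case/andP: (yn n).
    have := bernoulli_le (n * 2 ^ n) h; apply: le_trans.
    by rewrite natrM natrX exprMn mulrN mulrA.
  - rewrite -[X in _ --> X]subr0; apply: cvgB; first exact: cvg_cst.
    by apply: cvg_mulrn_expr; lra.
  - exact: cvg_cst.
apply: (@squeeze_cvgr _ _ _ _ (fun=> 0) (fun n => n.+1%:R^-1)).
- near=> n; have := v0 n; move: (yn n); set a := y ^+ n.
  set k := (n * 2 ^ n)%N => /andP[a0 a1] /[dup] vk0 ->/=.
  (* At or above the threshold, (1 - a)^k is at most 1 / (1 + a)^k, and Bernoulli's inequality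
     bounds (1 + a)^k below by 1 + k a, where k a = n (2 y)^n >= n. *)
  have h : 1 + n%:R <= (1 + a) ^+ k.
    have h : -1 <= a by lra.
    apply: le_trans (bernoulli_le k h).
    rewrite lerD2l /k natrM -mulrA ler_peMr ?ler0n//.
    rewrite natrX /a -exprMn exprn_ege1//; lra.
  have : (1 - a) ^+ k * (1 + a) ^+ k <= 1.
    rewrite -exprMn exprn_ile1//; have := mulr_ge0 a0 a0; nra.
  rewrite -[_^-1]mul1r ler_pdivlMr ?ltr0Sn// -natr1 [n%:R + 1]addrC.
  by move=> hk; apply: le_trans hk; rewrite ler_wpM2l.
- exact: cvg_cst.
- exact: cvg_harmonic.
Unshelve. all: by end_near. Qed.

End Threshold.

(** * Measurable sets whose indicators are weighted L^1 limits of trigonometric polynomials *)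

Section Approximable.
Variable R : realType.
Local Notation C := R[i].
Local Notation T := (circle R).
Local Notation mu := (@circle_measure R).
Variable w : T -> R.
Hypotheses (w0 : forall x, 0 <= w x) (iw : rintegrable w).
Implicit Types (u v p q : T -> R) (E F : set T).

(** The weight stands for the modulus of the function against which [p] will be integrated. The
    bounds on [p] make products stay close to intersections. *)
Definition approximable E := measurable E /\ forall e, 0 < e -> exists p,
  [/\ rtrig p, forall x, 0 <= p x <= 1 &
      rint (fun x => `|p x - \1_E x| * w x) <= e].

Lemma indic_itv E (x : T) : 0 <= (\1_E x : R) <= 1.
Proof. by rewrite indicE; case: (_ \in _); rewrite ?lexx ?ler01. Qed.

Lemma measurable_indicR E : measurable E -> measurable_fun setT (\1_E : T -> R).
Proof. by move=> mE; exact: measurable_indic. Qed.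

Lemma weight_rintegrable p E : measurable_fun setT p ->
  (forall x, 0 <= p x <= 1) -> measurable E ->
  rintegrable (fun x => `|p x - \1_E x| * w x).
Proof.
move=> mp p01 mE; apply: rintegrable_le iw.
  apply: measurable_funM; last exact: rintegrable_measurable.
  apply: measurableT_comp => //; apply: measurable_funB => //.
move=> x; rewrite normrM normr_id (ger0_norm (w0 x)) ler_piMl//.
by have := p01 x; have := indic_itv E x; rewrite ler_norml; lra.
Qed.

Lemma approximableC E : approximable E -> approximable (~` E).
Proof.
move=> [mE aE]; split; first exact: measurableC.
move=> e /aE[p [tp p01 pe]]; exists (fun x => 1 - p x); split.
- exact: rtrigC.
- by move=> x; have := p01 x; lra.
- apply: le_trans pe; rewrite le_eqVlt; apply/orP; left; apply/eqP.
  congr rint; apply/funext => x; congr (_ * _).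
  rewrite [X in _ - X](_ : _ = 1 - \1_E x); last first.
    by rewrite indicC indicE; case: (x \in E) => /=; rewrite ?subrr ?subr0.
  by rewrite [RHS]distrC; congr `|_|; ring.
Qed.

Lemma approximableI E F :
  approximable E -> approximable F -> approximable (E `&` F).
Proof.
move=> [mE aE] [mF aF]; split; first exact: measurableI.
move=> e e0; have e2 : 0 < e / 2 by rewrite divr_gt0.
have [p [tp p01 pe]] := aE _ e2; have [q [tq q01 qe]] := aF _ e2.
have pq01 x : 0 <= p x * q x <= 1.
  by have := p01 x; have := q01 x => /andP[? ?] /andP[? ?];
    rewrite mulr_ge0//= mulr_ile1.
have mp := measurable_rtrig tp; have mq := measurable_rtrig tq.
exists (fun x => p x * q x); split => //; first exact: rtrigM.
have ip := weight_rintegrable mp p01 mE.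
have iq := weight_rintegrable mq q01 mF.
apply: le_trans (_ : e / 2 + e / 2 <= _); last by rewrite -splitr.
apply: le_trans (lerD pe qe); rewrite -rintD//.
apply: rint_le; [|exact: rintegrableD|].
  by apply: weight_rintegrable => //; [exact: measurable_funM|exact: measurableI].
move=> x; rewrite -mulrDl ler_wpM2r//.
rewrite [X in _ - X](_ : _ = \1_E x * \1_F x); last by rewrite indicI.
have -> : p x * q x - \1_E x * \1_F x =
  (p x - \1_E x) * q x + \1_E x * (q x - \1_F x) by ring.
apply: le_trans (ler_normD _ _) _; rewrite !normrM; apply: lerD.
  by rewrite ler_piMr//; have := q01 x; rewrite ler_norml; lra.
by rewrite ler_piMl//; have := indic_itv E x; rewrite ler_norml; lra.
Qed.

Lemma approximableU E F :
  approximable E -> approximable F -> approximable (E `|` F).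
Proof.
move=> aE aF; rewrite -[_ `|` _]setCK setCU; apply: approximableC.
by apply: approximableI; exact: approximableC.
Qed.

Lemma rint_weight_cvg0 (p_ : nat -> T -> R) E :
  (forall n, measurable_fun setT (p_ n)) -> (forall n x, 0 <= p_ n x <= 1) ->
  measurable E -> (forall x, p_ n x @[n --> \oo] --> (\1_E x : R)) ->
  rint (fun x => `|p_ n x - \1_E x| * w x) @[n --> \oo] --> 0.
Proof.
move=> mp p01 mE pE; have mw := rintegrable_measurable iw.
have -> : (fun n => rint (fun x => `|p_ n x - \1_E x| * w x)) =
    (fun n => rint (fun x => `|p_ n x * w x - \1_E x * w x|)).
  apply/funext => n; congr rint; apply/funext => x.
  by rewrite -mulrBl normrM (ger0_norm (w0 x)).
apply: (@rint_dct0 _ (fun n x => p_ n x * w x) _ w) => //.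
- by move=> n; exact: measurable_funM.
- by apply: measurable_funM => //; exact: measurable_indicR.
- by move=> x; apply: cvgM; [exact: pE|exact: cvg_cst].
- move=> n x; rewrite normrM (ger0_norm (w0 x)) ler_piMl//.
  by have := p01 n x; rewrite ler_norml; lra.
Qed.

(** The indicators of the finite unions converge pointwise, and dominated convergence with the
    weight as majorant makes one of them close enough; that one is approximable. *)
Lemma approximable_bigcup (F : nat -> set T) :
  (forall n, approximable (F n)) -> approximable (\bigcup_n F n).
Proof.
move=> aF.
pose U n := \big[setU/set0]_(i < n) F i.
have aU n : approximable (U n).
  rewrite /U; elim: n => [|n ih].
    rewrite big_ord0; split => // e e0.
    exists (fun=> 0); split; [exact: rtrig_cst|by move=> x; rewrite lexx ler01|].
    under eq_fun do rewrite indic0 subrr normr0 mul0r.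
    by rewrite rint_cst ltW.
  by rewrite big_ord_recr; exact: approximableU.
have mU : measurable (\bigcup_n F n).
  by apply: bigcupT_measurable => n; case: (aF n).
split=> // e e0.
have cU x : (\1_(U n) x : R) @[n --> \oo] --> (\1_(\bigcup_n F n) x : R).
  have [[k _ Fk]|nF] := pselect ((\bigcup_n F n) x).
    rewrite [X in _ --> X]indicE mem_set; last by exists k.
    apply: cvg_near_cst; exists k.+1 => // n /= kn.
    rewrite indicE mem_set// /U -bigcup_mkord; by exists k.
  rewrite [X in _ --> X]indicE memNset//; apply: cvg_near_cst.
  apply: nearW => n; rewrite indicE memNset// /U -bigcup_mkord => -[k _ Fk].
  by apply: nF; exists k.
have e2 : 0 < e / 2 by rewrite divr_gt0.
have mUn n : measurable (U n) by case: (aU n).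
have := rint_weight_cvg0 (fun n => measurable_indicR (mUn n))
  (fun n => indic_itv (U n)) mU cU.
move=> /cvgr0Pnorm_le/(_ _ e2)[N _ /(_ N (leqnn N)) /= hN].
have [_ /(_ _ e2)[p [tp p01 pe]]] := aU N.
exists p; split => //.
have mp := measurable_rtrig tp.
have i1 := weight_rintegrable mp p01 (mUn N).
have i2 := weight_rintegrable (measurable_indicR (mUn N)) (indic_itv (U N)) mU.
apply: le_trans (_ : e / 2 + e / 2 <= _); last by rewrite -splitr.
apply: le_trans (lerD pe (le_trans (ler_norm _) hN)).
rewrite -rintD//; apply: rint_le; [|exact: rintegrableD|].
  exact: weight_rintegrable.
move=> x; rewrite -mulrDl ler_wpM2r//.
by apply: le_trans (ler_normD _ _); rewrite addrA subrK.
Qed.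

(** The threshold polynomials evaluated at [u] are again trigonometric, and they tend to the
    indicator at every point, including those where [u] equals 1/2. *)
Lemma approximable_lt u : rtrig u -> (forall x, 0 <= u x <= 1) ->
  approximable [set x | u x < 2^-1].
Proof.
move=> tu u01; set E := [set x | _].
have mE : measurable E.
  have -> : E = setT `&` u @^-1` `]-oo, 2^-1[.
    by apply/seteqP; split=> x /=; rewrite in_itv /E //= => -[].
  exact: (measurable_rtrig tu).
split=> // e e0.
pose p n x := (1 - u x ^+ n) ^+ (n * 2 ^ n).
have tp n : rtrig (p n) by exact/rtrigX/rtrigC/rtrigX.
have p01 n x : 0 <= p n x <= 1.
  have /andP[u0 u1] := u01 x.
  have h : 0 <= u x ^+ n <= 1 by rewrite exprn_ge0//= exprn_ile1.
  have /andP[h0 h1] := h.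
  by rewrite exprn_ge0 ?subr_ge0//= exprn_ile1// ?subr_ge0// gerBl.
have pE x : p n x @[n --> \oo] --> (\1_E x : R).
  have := threshold_cvg (u01 x); rewrite indicE.
  suff -> : (x \in E) = (u x < 2^-1) by [].
  by apply/idP/idP => [/set_mem//|h]; exact/mem_set.
have := rint_weight_cvg0 (fun n => measurable_rtrig (tp n)) p01 mE pE.
move=> /cvgr0Pnorm_le/(_ _ e0)[N _ /(_ N (leqnn N)) /= hN].
by exists (p N); split => //; exact: le_trans (ler_norm _) hN.
Qed.

End Approximable.

(** * The argument on the circle, and approximability of all measurable sets *)

Section Argument.
Variable R : realType.
Local Notation T := (circle R).
Variable w : T -> R.
Hypotheses (w0 : forall x, 0 <= w x) (iw : rintegrable w).
Local Notation approximable := (approximable w).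

(** The argument divided by 2 pi, with values in [0, 1[. Since [acos] only sees the real part, the
    lower half circle is obtained by reflection. Being a right inverse of [expi], it exhibits every
    measurable set of the circle as the preimage of a Borel set of the line. *)
Definition circle_arg (x : T) : R :=
  if 0 <= Im (cval x) then acos (Re (cval x)) / (2 * pi)
  else 1 - acos (Re (cval x)) / (2 * pi).

Lemma circle_argK : cancel circle_arg (@expi R).
Proof.
move=> x; apply: val_inj => /=; rewrite /circle_arg.
have xR := Re_cval_itv x.
have pi2 : 2 * pi != 0 :> R by rewrite mulf_neq0// gt_eqF// pi_gt0.
have cE : cos (acos (Re (cval x))) = Re (cval x).
  by apply: acosK; rewrite in_itv.
have sE : sin (acos (Re (cval x))) = `|Im (cval x)|.
  rewrite sin_acos// -sqrtr_sqr; congr Num.sqrt.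
  have := sqr_normcE (cval x); rewrite norm_cval; lra.
case: ifPn => h.
  rewrite mulrC divfK// cE sE ger0_norm//; by case: (cval x).
rewrite mulrBr mulr1 [2 * pi * (_ / _)]mulrC divfK//.
have -> : 2 * pi - acos (Re (cval x)) = - acos (Re (cval x)) + pi *+ 2 :> R.
  by rewrite mulr2n; ring.
rewrite cosD2pi sinD2pi cosN sinN cE sE ler0_norm ?opprK; last first.
  by rewrite ltW// ltNge.
by case: (cval x).
Qed.

Lemma approximableT : approximable setT.
Proof.
have -> : setT = [set x : T | (fun=> 0) x < 2^-1 :> R].
  by apply/seteqP; split => // x _ /=; rewrite invr_gt0.
by apply: approximable_lt => //; [exact: rtrig_cst|move=> x; rewrite lexx ler01].
Qed.

Lemma approximable0 : approximable set0.
Proof. by rewrite -setCT; apply: approximableC => //; exact: approximableT. Qed.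

(** Since |a (p - b)| <= 2, the function 1/2 + a (p - b) / 4 has values in [0, 1], and it is below
    1/2 exactly on the given set. *)
Lemma approximable_affine (p : T -> R) (a b : R) : rtrig p ->
  (forall x, -1 <= p x <= 1) -> -1 <= b <= 1 -> -1 <= a <= 1 ->
  approximable [set x | a * (p x - b) < 0].
Proof.
move=> tp p1 b1 a1.
have -> : [set x | a * (p x - b) < 0] =
    [set x | 2^-1 + (4^-1 * a) * (p x + - b) < 2^-1].
  apply/seteqP; split => x /=; lra.
apply: approximable_lt => //.
  apply: rtrigD; first exact: rtrig_cst.
  apply: rtrigM; first exact: rtrig_cst.
  by apply: rtrigD => //; exact: rtrig_cst.
move=> x; have /andP[h1 h2] := p1 x; case/andP: b1 => b1 b2.
have : `|a * (p x - b)| <= 2.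
  rewrite normrM; apply: le_trans (_ : 1 * 2 <= _); last by lra.
  by apply: ler_pM => //; rewrite ler_norml; lra.
by rewrite ler_norml; lra.
Qed.

(** For s in [0, pi] the cosine is decreasing, so the set is an arc cut out by a half plane;
    otherwise it is everything or empty. *)
Lemma approximable_acos_gt (s : R) :
  approximable [set x | s < acos (Re (cval x))].
Proof.
have a0 (x : T) := acos_ge0 (Re_cval_itv x).
have api (x : T) := acos_lepi (Re_cval_itv x).
have [s0|s0] := ltP s 0.
  have -> : [set x : T | s < acos (Re (cval x))] = setT.
    by apply/seteqP; split => // x _ /=; exact: lt_le_trans (a0 x).
  exact: approximableT.
have [spi|spi] := ltP pi s.
  have -> : [set x : T | s < acos (Re (cval x))] = set0.
    by apply/seteqP; split => // x /=; have := api x; lra.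
  exact: approximable0.
have -> : [set x : T | s < acos (Re (cval x))] =
    [set x : T | 1 * (Re (cval x) - cos s) < 0].
  have E x : (s < acos (Re (cval x))) = (1 * (Re (cval x) - cos s) < 0).
    rewrite mul1r subr_lt0 -[X in X < cos s](acosK (x := Re (cval x))).
      by rewrite ltr_cos// in_itv/= ?a0 ?api// s0.
    by rewrite in_itv/= Re_cval_itv.
  by apply/seteqP; split => x /=; rewrite E.
apply: approximable_affine; first exact: rtrig_Re.
- exact: Re_cval_itv.
- by rewrite cos_geN1 cos_le1.
- by rewrite lexx andbT; lra.
Qed.

Lemma approximable_acos_lt (s : R) :
  approximable [set x | acos (Re (cval x)) < s].
Proof.
have a0 (x : T) := acos_ge0 (Re_cval_itv x).
have api (x : T) := acos_lepi (Re_cval_itv x).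
have [s0|s0] := ltP s 0.
  have -> : [set x : T | acos (Re (cval x)) < s] = set0.
    by apply/seteqP; split => // x /=; have := a0 x; lra.
  exact: approximable0.
have [spi|spi] := ltP pi s.
  have -> : [set x : T | acos (Re (cval x)) < s] = setT.
    by apply/seteqP; split => // x _ /=; exact: le_lt_trans (api x) _.
  exact: approximableT.
have -> : [set x : T | acos (Re (cval x)) < s] =
    [set x : T | -1 * (Re (cval x) - cos s) < 0].
  have E x : (acos (Re (cval x)) < s) = (-1 * (Re (cval x) - cos s) < 0).
    rewrite mulN1r oppr_lt0 subr_gt0 -[X in cos s < X](acosK (x := Re (cval x))).
      by rewrite ltr_cos// in_itv/= ?a0 ?api// s0.
    by rewrite in_itv/= Re_cval_itv.
  by apply/seteqP; split => x /=; rewrite E.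
apply: approximable_affine; first exact: rtrig_Re.
- exact: Re_cval_itv.
- by rewrite cos_geN1 cos_le1.
- by rewrite lexx /=; lra.
Qed.

Lemma approximable_arg_ray (c : R) :
  approximable (circle_arg @^-1` `]c, +oo[).
Proof.
(* The open lower half circle, on which a larger argument means a smaller value of [acos]. *)
pose L := [set x : T | 1 * (Im (cval x) - 0) < 0].
have aL : approximable L.
  apply: approximable_affine; first exact: rtrig_Im.
  - exact: Im_cval_itv.
  - by lra.
  - by rewrite lexx andbT; lra.
have -> : circle_arg @^-1` `]c, +oo[ =
    (~` L `&` [set x | c * (2 * pi) < acos (Re (cval x))]) `|`
    (L `&` [set x | acos (Re (cval x)) < (1 - c) * (2 * pi)]).
  have pi0 : 0 < 2 * pi :> R by rewrite mulr_gt0// pi_gt0.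
  apply/seteqP; split => x; rewrite /= in_itv/= andbT /circle_arg.
    case: ifPn => h.
      rewrite ltr_pdivlMr// => h2; left; split => //.
      by rewrite /L/= mul1r subr0; apply/negP; rewrite -leNgt.
    move=> h2; right; split; first by rewrite /L/= mul1r subr0 ltNge.
    by rewrite -ltr_pdivrMr//; lra.
  rewrite /L/= mul1r subr0 => -[[]|[]].
    by move=> /negP; rewrite -leNgt => -> h2; rewrite ltr_pdivlMr.
  by rewrite leNgt => ->/=; rewrite -ltr_pdivrMr//; lra.
apply: approximableU => //; apply: approximableI => //.
- exact: approximableC.
- exact: approximable_acos_gt.
- exact: approximable_acos_lt.
Qed.

(* The approximable sets form a sigma-algebra, which contains the preimages of the
   rays under the argument. *)
Lemma approximable_measurable (E : set T) : measurable E -> approximable E.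
Proof.
move=> mE.
have mB : measurable (@expi R @^-1` E).
  by rewrite -[X in measurable X]setTI; exact: measurable_expi.
have -> : E = circle_arg @^-1` (@expi R @^-1` E).
  by apply/seteqP; split => x /=; rewrite circle_argK.
move: (expi (R:=R) @^-1` E) mB => B mB {mE}.
pose G := [set B : set R | approximable (circle_arg @^-1` B)].
have sG : sigma_algebra setT G.
  split.
  - by rewrite /G/= preimage_set0; exact: approximable0.
  - by move=> A; rewrite /G/= setTD preimage_setC; exact: approximableC.
  - move=> F GF; rewrite /G/= preimage_bigcup.
    exact: approximable_bigcup.
suff : measurable `<=` G by exact.
move=> A; rewrite -[measurable]/((R.-ocitv.-measurable).-sigma.-measurable).
rewrite RGenOInfty.measurableE; apply: smallest_sub => //.
by move=> _ [c ->]; exact: approximable_arg_ray.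
Qed.

End Argument.

(** * Fourier coefficients *)

Section FourierBasis.
Variable R : realType.
Local Notation C := R[i].
Local Notation T := (circle R).
Local Notation L0 := (L0 R).
Local Notation mu := (@circle_measure R).

Lemma expiX (t : R) n :
  cval (expi t) ^+ n = cos (n%:R * (2 * pi) * t) +i* sin (n%:R * (2 * pi) * t).
Proof.
elim: n => [|n ih]; first by rewrite expr0 !mul0r cos0 sin0.
rewrite exprS ih -natr1 [RHS](_ : _ =
  cos (2 * pi * t + n%:R * (2 * pi) * t) +i*
  sin (2 * pi * t + n%:R * (2 * pi) * t)).
  by rewrite cosD sinD [LHS]/GRing.mul /= [X in _ +i* X]addrC.
by congr (_ +i* _); congr (_ _); ring.
Qed.

Lemma rint_expi (u : T -> R) : rintegrable u ->
  rint u = Rintegral lebesgue_measure `[0, 1] (fun t => u (expi t)).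
Proof.
move=> iu; have mu0 := rintegrable_measurable iu.
have m01 : measurable (`[0%R, 1%R] : set R) := measurable_itv _.
pose nu := [the measure _ _ of mrestr (@lebesgue_measure R) m01].
have mE : measurable_fun setT (EFin \o u) by exact/measurable_EFinP.
have mexpi : @measurable_fun _ _ (measurableTypeR R) T setT (@expi R).
  exact: measurable_expi.
have mE' : @measurable_fun _ _ (measurableTypeR R) _ setT
    (EFin \o (u \o @expi R)).
  by apply/measurable_EFinP; exact: measurableT_comp mexpi.
have inu : nu.-integrable setT (EFin \o (u \o @expi R)).
  apply/integrableP; split => //; case/integrableP : iu => _.
  have := @ge0_integral_pushforward _ _ _ _ _ _ mexpi
    nu setT (abse \o (EFin \o u)) measurableT.
  rewrite preimage_setT => E; rewrite -E//; first exact: measurableT_comp.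
  by move=> y _ /=.
rewrite /rint /Rintegral; congr fine.
have := @integral_pushforward _ _ _ _ _ _ mexpi nu setT (EFin \o u) mE.
rewrite preimage_setT => E; rewrite [LHS]E//.
(* The restricted measure still lives on the whole line; the complement of [0, 1] is null for it and
   is removed here. *)
rewrite (@negligible_integral _ (measurableTypeR R) R nu setT
  (~` (`[0%R, 1%R] : set (measurableTypeR R))))//.
- rewrite setTD setCK; apply: eq_measure_integral => A mA A01.
  by rewrite /nu /= /mrestr setIidl.
- exact: measurableC.
- by rewrite /nu /= /mrestr setICl measure0.
Qed.

Lemma Rintegral01_primitive (f F : R -> R) :
  (forall x : R, is_derive x 1 F (f x)) -> continuous f ->
  Rintegral lebesgue_measure `[0, 1] f = F 1 - F 0.
Proof.
move=> dF cf; have cF x : {for x, continuous F}.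
  by apply: differentiable_continuous; apply/derivable1_diffP; have [] := dF x.
rewrite /Rintegral (@continuous_FTC2 _ _ F)//.
- exact: continuous_subspaceT.
- split.
  + by move=> x _; have [] := dF x.
  + by apply: cvg_at_right_filter; exact: cF.
  + by apply: cvg_at_left_filter; exact: cF.
- by move=> x _; rewrite derive1E; have [_ ->] := dF x.
Qed.

Lemma expi1 : cval (expi (1 : R)) = 1.
Proof.
by rewrite /= mulr1 mulr_natl cos2pi sin2pi.
Qed.

Lemma integralL_zX n : integralL ((@zL R) ^+ n.+1) = 0.
Proof.
have mX m : cmeasurable (fun x : T => cval x ^+ m).
  elim: m => [|m ih].
    by under eq_fun do rewrite expr0; exact: cmeasurable_cst.
  under eq_fun do rewrite exprS; exact: cmeasurableM (@cmeasurable_cval R) ih.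
have -> m : @zL R ^+ m = classL (mX m).
  elim: m => [|m ih].
    by rewrite expr0 -cstLE1; exact/classL_eqP/aeW.
  rewrite exprS ih /zL classLM; apply/classL_eqP/aeW => x.
  by rewrite exprS.
have iX : rintegrable (fun x : T => normc (cval x ^+ n.+1)).
  have E (x : T) : normc (cval x ^+ n.+1) = 1.
    by elim: n.+1 => [|m ih]; rewrite ?normc1// exprS normcM norm_cval ih mulr1.
  by under eq_fun do rewrite E; exact: rintegrable_cst.
rewrite integralL_class !rint_expi; [|exact: rintegrable_Im|exact: rintegrable_Re].
(* The primitives sin (k t) / k and - cos (k t) / k exist because k is nonzero, and they agree at 0
   and 1 because exp (i k) = 1. *)
set k : R := n.+1%:R * (2 * pi).
have k0 : k != 0.
  by rewrite mulf_neq0// ?pnatr_eq0// mulf_neq0// gt_eqF// pi_gt0.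
have := expiX 1 n.+1; rewrite expi1 expr1n -/k mulr1 => -[ck sk].
have ckx (x : R) : {for x, continuous ( *%R k)} by exact: mulrl_continuous.
congr (_ +i* _); under eq_Rintegral do rewrite expiX/= -/k.
- have dF (x : R) : is_derive x 1 (fun t => k^-1 * sin (k * t)) (cos (k * x)).
    by apply: is_derive_eq; rewrite /GRing.scale/=; field.
  rewrite (Rintegral01_primitive dF); last first.
    by move=> x; apply: continuous_comp => //; exact: continuous_cos.
  by rewrite mulr1 mulr0 -sk sin0 subrr.
- have dF (x : R) : is_derive x 1 (fun t => - k^-1 * cos (k * t)) (sin (k * x)).
    by apply: is_derive_eq; rewrite /GRing.scale/=; field.
  rewrite (Rintegral01_primitive dF); last first.
    by move=> x; apply: continuous_comp => //; exact: continuous_sin.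
  by rewrite mulr1 mulr0 -ck cos0 subrr.
Qed.

End FourierBasis.

(** * An L^1 function is determined by its Fourier coefficients *)

Section FourierUniqueness.
Variable R : realType.
Local Notation C := R[i].
Local Notation T := (circle R).
Local Notation L0 := (L0 R).
Local Notation mu := (@circle_measure R).
Implicit Types (f g h : L0) (p q : T -> R).

Definition null_coefs h := L1 h /\ forall n,
  integralL (h * zL ^+ n) = 0 /\ integralL (h * conjL zL ^+ n) = 0.

Lemma z_conjz : zL * conjL zL = 1 :> L0.
Proof. exact: unimodular_z. Qed.

Lemma unimodular_zX n : unimodular (@zL R ^+ n).
Proof. exact/unimodularX/unimodular_z. Qed.

Lemma unimodular_zcX n : unimodular (conjL (@zL R) ^+ n).
Proof. exact/unimodularX/unimodular_conj/unimodular_z. Qed.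

Lemma null_coefsD g h : null_coefs g -> null_coefs h -> null_coefs (g + h).
Proof.
move=> [lg cg] [lh ch]; split=> [|n]; first exact: L1D.
have [g1 g2] := cg n; have [h1 h2] := ch n.
split; rewrite mulrDl integralLD ?g1 ?g2 ?h1 ?h2 ?addr0// mulrC;
  apply: L1_umul => //; (exact: unimodular_zX || exact: unimodular_zcX).
Qed.

Lemma null_coefsZ c h : null_coefs h -> null_coefs (cstL c * h).
Proof.
move=> [lh ch]; split=> [|n]; first exact: L1Z.
have [h1 h2] := ch n.
split; rewrite -mulrA integralLZ ?h1 ?h2 ?mulr0// mulrC;
  apply: L1_umul => //; (exact: unimodular_zX || exact: unimodular_zcX).
Qed.

(** Multiplication by z shifts the coefficients. The test by conj z to the power 0 becomes a test by
    z, hence the case distinction. *)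
Lemma null_coefsz h : null_coefs h -> null_coefs (zL * h).
Proof.
move=> [lh ch]; split=> [|n].
  by apply: L1_umul => //; exact: unimodular_z.
rewrite [zL * h]mulrC; split; first by rewrite -mulrA -exprS (ch _).1.
case: n => [|n]; first by have [] := ch 1%N; rewrite expr0 mulr1 expr1.
by rewrite -mulrA exprS (mulrA zL) z_conjz mul1r (ch _).2.
Qed.

Lemma null_coefszc h : null_coefs h -> null_coefs (conjL zL * h).
Proof.
move=> [lh ch]; split=> [|n].
  by apply: L1_umul => //; exact/unimodular_conj/unimodular_z.
rewrite [conjL zL * h]mulrC; split; last by rewrite -mulrA -exprS (ch _).2.
case: n => [|n]; first by have [] := ch 1%N; rewrite expr0 mulr1 expr1.
by rewrite -mulrA exprS (mulrA (conjL zL)) (mulrC (conjL zL)) z_conjz mul1r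
  (ch _).1.
Qed.

Lemma cmeasurable_real p :
  measurable_fun setT p -> cmeasurable (fun x => (p x)%:C).
Proof. by move=> mp; split => //; exact: measurable_cst. Qed.

Definition realL p (mp : measurable_fun setT p) : L0 :=
  classL (cmeasurable_real mp).

Lemma realL_cst c (mc : measurable_fun setT (fun=> c)) :
  realL mc = cstL c%:C.
Proof. exact/classL_eqP/aeW. Qed.

Lemma realLD p q mp mq mpq : @realL (fun x => p x + q x) mpq =
  @realL p mp + @realL q mq.
Proof.
by rewrite /realL classLD; apply/classL_eqP/aeW => x; rewrite !fctE -rmorphD.
Qed.

Lemma realLM p q mp mq mpq : @realL (fun x => p x * q x) mpq =
  @realL p mp * @realL q mq.
Proof.
by rewrite /realL classLM; apply/classL_eqP/aeW => x; rewrite !fctE -rmorphM.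
Qed.

Lemma realL_Re m : @realL (fun x => Re (cval x)) m =
  cstL 2^-1 * (zL + conjL zL).
Proof.
rewrite /realL /zL classL_conj classLD classL_mulcst.
by apply/classL_eqP/aeW => x; rewrite !fctE ReJ_add mulrC.
Qed.

Lemma realL_Im m : @realL (fun x => Im (cval x)) m =
  cstL (2^-1 * 'i%C) * (conjL zL - zL).
Proof.
rewrite /realL /zL classL_conj classLB classL_mulcst.
by apply/classL_eqP/aeW => x; rewrite !fctE ImJ_sub -mulrA mulrC.
Qed.

Lemma null_coefs_rtrig p (mp : measurable_fun setT p) h :
  rtrig p -> null_coefs h -> null_coefs (realL mp * h).
Proof.
move=> tp; elim: tp mp h => {p} [c|||p q tp ihp tq ihq|p q tp ihp tq ihq] mp h nh.
- by rewrite realL_cst; exact: null_coefsZ.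
- rewrite realL_Re -mulrA; apply: null_coefsZ; rewrite mulrDl.
  by apply: null_coefsD; [exact: null_coefsz|exact: null_coefszc].
- rewrite realL_Im -mulrA; apply: null_coefsZ.
  rewrite mulrBl -[X in _ - X]mul1r -mulNr -cstLE1 -rmorphN/=.
  by apply: null_coefsD; [exact: null_coefszc|apply/null_coefsZ/null_coefsz].
- rewrite (realLD (measurable_rtrig tp) (measurable_rtrig tq)) mulrDl.
  by apply: null_coefsD; [exact: ihp|exact: ihq].
- rewrite (realLM (measurable_rtrig tp) (measurable_rtrig tq)) -mulrA.
  by apply: ihp; exact: ihq.
Qed.

Lemma realL_mul_class p (mp : measurable_fun setT p) (F : T -> C)
  (mF : cmeasurable F) :
  realL mp * classL mF = classL (cmeasurableM (cmeasurable_real mp) mF).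
Proof. exact: classLM. Qed.

Lemma normcR (a : R) : normc a%:C = `|a|.
Proof. by rewrite /= expr0n addr0 sqrtr_sqr. Qed.

(** The integral of p h is zero for every trigonometric polynomial p, and p can be chosen close to
    the indicator in the L^1 norm with weight |h|. *)
Lemma null_coefs_indic h (E : set T) (mE : measurable E) : null_coefs h ->
  integralL (realL (measurable_indicR mE) * h) = 0.
Proof.
move=> nh; have [lh ch] := nh.
pose w x := normc (reprL h x).
have w0 x : 0 <= w x by exact: normc_ge0.
apply: eq0_normc; apply/eqP; rewrite eq_le normc_ge0 andbT.
apply/ler_addgt0Pr => e e0; rewrite add0r.
have [_ /(_ _ e0)[p [tp p01 pe]]] := approximable_measurable w0 lh mE.
have mp := measurable_rtrig tp.
set mI := measurable_indicR mE.
have [] := null_coefs_rtrig mp tp nh => lph /(_ 0%N)[+ _].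
rewrite expr0 mulr1 => ph0.
have lIh : L1 (realL mI * h).
  apply: LinftyL1 => //; apply: (@Linfty_class _ _ _ 1) => x.
  by rewrite normcR ger0_norm; have := indic_itv E x => /andP[].
rewrite -[integralL _]subr0 -ph0 -integralLB//.
have -> : realL mI * h - realL mp * h = (realL mI - realL mp) * h.
  by rewrite mulrBl.
apply: le_trans pe; apply: le_trans (normc_integralL _) _.
  by rewrite mulrBl; exact: L1B.
have -> : N1 ((realL mI - realL mp) * h) = rint (fun x => `|p x - \1_E x| * w x).
  rewrite -{1}(reprLK h) /realL classLB classLM N1_class; congr rint.
  by apply/funext => x; rewrite !fctE normcM -rmorphB normcR distrC.
by [].
Qed.

Lemma rint_indic_eq0 (u : T -> R) : rintegrable u ->
  (forall E, measurable E -> rint (fun x => \1_E x * u x) = 0) ->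
  {ae mu, forall x, u x = 0}.
Proof.
move=> iu uE.
have := @integral_ae_eq _ _ _ mu setT measurableT (cst 0%E) (EFin \o u) iu.
move=> /(_ (measurable_cst _)) h.
have {}h : ae_eq mu setT (EFin \o u) (cst 0%E).
  apply: h => E _ mE; rewrite integral0 integral_mkcond.
  have -> : (EFin \o u) \_ E = EFin \o (fun x => \1_E x * u x).
    apply/funext => x; rewrite /patch /= indicE.
    by case: ifP => _; rewrite ?mul1r ?mul0r.
  have i : rintegrable (fun x => \1_E x * u x).
    apply: rintegrable_le (integrable_norm iu).
      apply: measurable_funM; first exact: measurable_indicR.
      exact: rintegrable_measurable.
    move=> x /=; rewrite normrM ler_piMl// ger0_norm;
      by have := indic_itv E x => /andP[].
  have -> : 0%E = (rint (fun x => \1_E x * u x))%:E by rewrite uE.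
  by rewrite /rint /Rintegral fineK// integrable_fin_num.
by apply: filterS h => x /= /(_ I)[].
Qed.

(** The generality of L^1 matters: [conjugation_zE] applies this to a product of two L^2
    functions. *)
Lemma fourier_uniqueness h : null_coefs h -> h = 0.
Proof.
move=> nh; have [lh _] := nh.
have mh := cmeasurable_reprL h.
have cE E (mE : measurable E) := null_coefs_indic mE nh.
have H E (mE : measurable E) :
    rint (fun x => \1_E x * Re (reprL h x)) = 0 /\
    rint (fun x => \1_E x * Im (reprL h x)) = 0.
  have := cE _ mE; rewrite -(reprLK h) realL_mul_class integralL_class reprLK.
  move=> [h1 h2]; split; [rewrite -[RHS]h1|rewrite -[RHS]h2];
  by congr rint; apply/funext => x; rewrite !fctE; case: (reprL h x) => a b /=;
    rewrite mul0r ?subr0 ?addr0.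
have hR := rint_indic_eq0 (rintegrable_Re mh lh) (fun E mE => (H E mE).1).
have hI := rint_indic_eq0 (rintegrable_Im mh lh) (fun E mE => (H E mE).2).
rewrite -(reprLK h) -(rmorph0 (@cstL R)); apply/classL_eqP.
by apply: filterS2 hR hI => x /=; case: (reprL h x) => a b /= -> ->.
Qed.

End FourierUniqueness.

(** * Completeness of L2 *)

Section RieszFischer.
Variable R : realType.
Local Notation C := R[i].
Local Notation T := (circle R).
Local Notation L0 := (L0 R).
Local Notation mu := (@circle_measure R).
Implicit Types (f g h : L0).

Lemma sum_half_le2 (c : R) n : 0 <= c ->
  \sum_(0 <= k < n) c * 2^-1 ^+ k <= c * 2.
Proof.
move=> c0; suff h : \sum_(0 <= k < n) c * 2^-1 ^+ k <= c * (2 - 2^-1 ^+ n * 2).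
  apply: le_trans h _; rewrite ler_wpM2l// gerBl mulr_ge0// exprn_ge0// invr_ge0 ler0n.
elim: n => [|n ih]; first by rewrite big_nil expr0 mul1r subrr mulr0.
rewrite big_nat_recr//=; apply: le_trans (lerD ih (lexx _)) _.
by rewrite -mulrDr ler_wpM2l// exprS; lra.
Qed.

(** By monotone convergence the sum of the series has integral at most 2 c, so it is finite almost
    everywhere. *)
Lemma ae_bounded_series (d_ : nat -> T -> R) (c : R) : 0 <= c ->
  (forall k x, 0 <= d_ k x) -> (forall k, rintegrable (d_ k)) ->
  (forall k, rint (d_ k) <= c * 2^-1 ^+ k) ->
  {ae mu, forall x, exists M, forall n, \sum_(0 <= k < n) d_ k x <= M}.
Proof.
move=> c0 d0 id dc.
pose D x := (\sum_(0 <= k <oo) (d_ k x)%:E)%E.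
have md k : measurable_fun setT (EFin \o d_ k).
  by apply/measurable_EFinP; exact: rintegrable_measurable.
have D0 x : (0 <= D x)%E by apply: nneseries_ge0 => k _ _; rewrite lee_fin.
have iD : mu.-integrable setT D.
  apply/integrableP; split.
    apply: (@ge0_emeasurable_sum _ _ _ setT (fun k => EFin \o d_ k) xpredT) => //.
    by move=> k x _ _; rewrite lee_fin.
  apply: (@le_lt_trans _ _ (c * 2)%:E); last exact: ltry.
  under eq_integral do rewrite gee0_abs//.
  rewrite integral_nneseries//; last by move=> k x _; rewrite lee_fin.
  apply: lime_le.
    by apply: is_cvg_nneseries => k _ _; apply: integral_ge0 => x _; rewrite lee_fin.
  apply: nearW => n; apply: le_trans (_ : (\sum_(0 <= k < n) c * 2^-1 ^+ k)%:E <= _)%E.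
    rewrite -sumEFin; apply: lee_sum => k _.
    rewrite -[leLHS]fineK; first by rewrite lee_fin dc.
    exact: (integrable_fin_num measurableT (id k)).
  by rewrite lee_fin sum_half_le2.
apply: filterS (integrable_ae measurableT iD) => x /= /(_ I) Dx.
exists (fine (D x)) => n; rewrite -lee_fin fineK// -sumEFin.
by apply: nneseries_lim_ge => k _ _; rewrite lee_fin.
Qed.

Lemma cvg_of_bounded_variation (u : nat -> R) (M : R) :
  (forall n, \sum_(0 <= k < n) `|u k.+1 - u k| <= M) -> cvgn u.
Proof.
move=> uM.
have : cvgn (series (fun k => u k.+1 - u k)).
  apply: normed_cvg; apply: nondecreasing_is_cvgn.
    apply/nondecreasing_seqP => n.
    rewrite /= -[leRHS]/(\sum_(0 <= k < n.+1) `|u k.+1 - u k|).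
    by rewrite big_nat_recr//= lerDl.
  by exists M => _ [n _ <-]; exact: uM.
have -> : series (fun k => u k.+1 - u k) = (fun n => u n - u 0%N).
  by apply/funext => n; rewrite /series /= telescope_sumr.
move=> cu; have -> : u = (fun n => u n - u 0%N) + cst (u 0%N).
  by apply/funext => n; rewrite !fctE subrK.
by apply: is_cvgD => //; exact: is_cvg_cst.
Qed.

Lemma measurable_ae_lim (u_ : nat -> T -> R) :
  (forall n, measurable_fun setT (u_ n)) ->
  {ae mu, forall x, cvgn (u_ ^~ x)} ->
  exists u : T -> R, measurable_fun setT u /\
    {ae mu, forall x, u_ n x @[n --> \oo] --> u x}.
Proof.
move=> mu_ [N [mN N0 cN]].
(* Set to 0 on the null set, the sequence converges everywhere, so that its limit is measurable. *)
pose v n x := u_ n x * \1_(~` N) x.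
have cv x : cvgn (v ^~ x).
  rewrite /v indicE; have [xN|xN] := boolP (x \in ~` N).
    under eq_fun do rewrite mulr1.
    by apply: contrapT => h; move/set_mem : xN; apply; exact: cN.
  by under eq_fun do rewrite mulr0; exact: is_cvg_cst.
exists (fun x => limn (v ^~ x)); split.
  apply: (measurable_fun_cvg (h := v)) => [n|x _]; last exact: cv.
  by apply: measurable_funM => //; apply: measurable_indicR; exact: measurableC.
exists N; split => // x /= h; apply: contrapT => xN; apply: h.
have vE : v ^~ x = u_ ^~ x.
  by apply/funext => n; rewrite /v indicE mem_set// mulr1.
by rewrite vE -/(cvgn (u_ ^~ x)) -vE; exact: cv.
Qed.

End RieszFischer.

Section Completeness.
Variable R : realType.
Local Notation C := R[i].
Local Notation T := (circle R).
Local Notation L0 := (L0 R).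
Local Notation mu := (@circle_measure R).
Implicit Types (f g h : L0).

Lemma limn_einf_ub (u : nat -> \bar R) (c : \bar R) :
  (forall n, (u n <= c)%E) -> (limn_einf u <= c)%E.
Proof.
move=> uc; rewrite limn_einf_lim; apply: lime_le.
  exact: is_cvg_einfs.
apply: nearW => n; apply: le_trans (uc n).
by apply: ereal_inf_lbound; exists n => /=.
Qed.

Lemma fatou_rint (u_ : nat -> T -> R) (u : T -> R) (c : R) :
  (forall n, rintegrable (u_ n)) -> measurable_fun setT u ->
  (forall n x, 0 <= u_ n x) -> (forall x, 0 <= u x) ->
  {ae mu, forall x, u_ n x @[n --> \oo] --> u x} ->
  (forall n, rint (u_ n) <= c) -> rintegrable u /\ rint u <= c.
Proof.
move=> iu mu0 u0 u00 cu uc.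
have mE n : measurable_fun setT (EFin \o u_ n).
  by apply/measurable_EFinP; exact: rintegrable_measurable.
have F := @fatou _ _ _ mu setT measurableT (fun n => EFin \o u_ n) mE
  (fun n x _ => u0 n x).
have le1 : (\int[mu]_x (u x)%:E <=
    \int[mu]_x limn_einf (fun n => (u_ n x)%:E))%E.
  apply: ae_ge0_le_integral => //.
  - by move=> x _; rewrite lee_fin.
  - exact/measurable_EFinP.
  - move=> x _; rewrite limn_einf_lim; apply: lime_ge.
      exact: is_cvg_einfs.
    apply: nearW => n; apply: le_ereal_inf_tmp => _ [m /= nm <-].
    by rewrite lee_fin.
  - rewrite /limn_einf; apply: measurableT_comp => //.
    apply: (@measurable_fun_limn_esup _ _ _ setT
      (fun n x => (- (u_ n x)%:E)%E)) => n.
    apply/(measurable_EFinP setT (fun x => - u_ n x)).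
    exact: measurable_funN (rintegrable_measurable (iu n)).
  - apply: filterS cu => x cx _.
    have /cvg_limn_einf_sup[-> _] : (u_ n x)%:E @[n --> \oo] --> (u x)%:E.
      by apply: cvg_EFin => //; exact: nearW.
    by [].
have le2 : (\int[mu]_x (u x)%:E <= c%:E)%E.
  apply: le_trans le1 (le_trans F _); apply: limn_einf_ub => n.
  rewrite -[leLHS]fineK; last exact: (integrable_fin_num measurableT (iu n)).
  by rewrite lee_fin; exact: uc.
have iu0 : rintegrable u.
  by apply/ge0_rintegrableP => //; exact: le_lt_trans le2 (ltry _).
split=> //; rewrite -lee_fin /rint /Rintegral fineK//.
exact: (integrable_fin_num measurableT iu0).
Qed.

Lemma exprV4 k : (4^-1 : R) ^+ k = (2^-1 ^+ k) * (2^-1 ^+ k).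
Proof. by rewrite -exprMn; congr (_ ^+ _); lra. Qed.

Lemma N2_1 : N2 (1 : L0) = 1.
Proof.
by have := innerprodff (@L2_1 R); rewrite /innerprod conjL1 mulr1 integralL1 => -[].
Qed.

(** The weight 2^k in [N1M_le], applied to f and 1, balances the two terms: both are then at most
    2^-k. *)
Lemma N1_le_half f k : L2 f -> N2 f <= 4^-1 ^+ k -> N1 f <= 2 * 2^-1 ^+ k.
Proof.
move=> lf fk; have p0 : 0 < 2^-1 ^+ k :> R by rewrite exprn_gt0.
have := N1M_le (_ : 0 < (2^-1 ^+ k)^-1) lf (@L2_1 R).
rewrite mulr1 invr_gt0 => /(_ p0); rewrite invrK N2_1 mulr1 => h.
apply: le_trans h _; rewrite mulrDl mul1r lerD2r.
by rewrite mulrC ler_pdivrMr// -exprV4.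
Qed.

(** The Cauchy condition is fast: successive distances in L^1 are summable, so the sequence itself
    converges almost everywhere and no subsequence is extracted. Fatou's lemma then bounds the
    distance to the limit. *)
Lemma L2_complete (g_ : nat -> L0) : (forall k, L2 (g_ k)) ->
  (forall k m, (k <= m)%N -> N2 (g_ m - g_ k) <= 4^-1 ^+ k) ->
  exists G, L2 G /\ forall k, N2 (G - g_ k) <= 4^-1 ^+ k.
Proof.
move=> lg cg; pose f k := reprL (g_ k); pose mf k := cmeasurable_reprL (g_ k).
have gB m k : g_ m - g_ k = classL (cmeasurableB (mf m) (mf k)).
  by rewrite -classLB !reprLK.
have lB m k : L2 (g_ m - g_ k) by exact: L2B.
pose d k x := normc (f k.+1 x - f k x).
have id k : rintegrable (d k) by have := L2_L1 (lB k.+1 k); rewrite gB => /L1_class.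
have dk k : rint (d k) <= 2 * 2^-1 ^+ k.
  by have := N1_le_half (lB k.+1 k) (cg _ _ (leqnSn k)); rewrite gB N1_class.
have bd := ae_bounded_series (ler0n R 2) (fun k x => normc_ge0 _) id dk.
have cR : {ae mu, forall x, cvgn (fun n => Re (f n x))}.
  apply: filterS bd => x [M hM]; apply: (@cvg_of_bounded_variation _ _ M) => n.
  by apply: le_trans (hM n); apply: ler_sum => k _; rewrite -ReB Re_le_normc.
have cI : {ae mu, forall x, cvgn (fun n => Im (f n x))}.
  apply: filterS bd => x [M hM]; apply: (@cvg_of_bounded_variation _ _ M) => n.
  by apply: le_trans (hM n); apply: ler_sum => k _; rewrite -ImB Im_le_normc.
have [ur [mr cr]] := measurable_ae_lim (fun n => (mf n).1) cR.
have [ui [mi ci]] := measurable_ae_lim (fun n => (mf n).2) cI.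
pose F x := ur x +i* ui x.
have mF : cmeasurable F by split.
have key k : rintegrable (fun x => normc (F x - f k x) ^+ 2) /\
    rint (fun x => normc (F x - f k x) ^+ 2) <= 4^-1 ^+ k.
  (* The shift by k keeps every term within the range of the Cauchy condition. *)
  apply: (@fatou_rint (fun n x => normc (f (n + k)%N x - f k x) ^+ 2)).
  - by move=> n; have := lB (n + k)%N k; rewrite gB => /L2_class.
  - exact: measurable_normc2 (cmeasurableB mF (mf k)).
  - by move=> n x; rewrite sqr_ge0.
  - by move=> x; rewrite sqr_ge0.
  - apply: filterS2 cr ci => x xr xi.
    under eq_fun do rewrite sqr_normcE Defs.ReB Defs.ImB.
    rewrite sqr_normcE Defs.ReB Defs.ImB.
    have xr' : Re (f (n + k)%N x) @[n --> \oo] --> ur x.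
      by rewrite (cvg_shiftn k (fun n => Re (f n x))).
    have xi' : Im (f (n + k)%N x) @[n --> \oo] --> ui x.
      by rewrite (cvg_shiftn k (fun n => Im (f n x))).
    under eq_fun do rewrite !expr2; rewrite !expr2.
    by apply: cvgD; apply: cvgM; apply: cvgB => //; exact: cvg_cst.
  - by move=> n; have := cg k (n + k)%N (leq_addl _ _); rewrite gB N2_class.
have GB k : classL mF - g_ k = classL (cmeasurableB mF (mf k)).
  by rewrite -classLB reprLK.
exists (classL mF); split=> [|k]; last first.
  by rewrite GB N2_class; exact: (key k).2.
rewrite -[classL mF](subrK (g_ 0%N)); apply: L2D => //.
by rewrite GB; apply/L2_class; exact: (key 0%N).1.
Qed.

End Completeness.

(** * Orthogonality and the projection onto H2 *)

Section InnerProduct.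
Variable R : realType.
Local Notation C := R[i].
Local Notation L0 := (L0 R).
Implicit Types (f g h : L0) (c : C).

Lemma L2MJ f g : L2 f -> L2 g -> L1 (f * conjL g).
Proof. by move=> lf /L2_conj; exact: L2M. Qed.

Lemma innerprodDl f g h : L2 f -> L2 g -> L2 h ->
  innerprod (f + g) h = innerprod f h + innerprod g h.
Proof.
by move=> lf lg lh; rewrite /innerprod mulrDl integralLD//; exact: L2MJ.
Qed.

Lemma innerprodBl f g h : L2 f -> L2 g -> L2 h ->
  innerprod (f - g) h = innerprod f h - innerprod g h.
Proof.
by move=> lf lg lh; rewrite /innerprod mulrBl integralLB//; exact: L2MJ.
Qed.

Lemma innerprodZl c f g : L2 f -> L2 g ->
  innerprod (cstL c * f) g = c * innerprod f g.
Proof.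
by move=> lf lg; rewrite /innerprod -mulrA integralLZ//; exact: L2MJ.
Qed.

Lemma innerprodC f g : L2 f -> L2 g -> innerprod g f = conjc (innerprod f g).
Proof.
move=> lf lg; rewrite /innerprod -integralL_conj; last exact: L2MJ.
by rewrite rmorphM/= conjLK mulrC.
Qed.

Lemma innerprodDr f g h : L2 f -> L2 g -> L2 h ->
  innerprod f (g + h) = innerprod f g + innerprod f h.
Proof.
move=> lf lg lh; rewrite innerprodC//; last exact: L2D.
by rewrite innerprodDl// (innerprodC lg lf) (innerprodC lh lf) rmorphD.
Qed.

Lemma innerprodBr f g h : L2 f -> L2 g -> L2 h ->
  innerprod f (g - h) = innerprod f g - innerprod f h.
Proof.
move=> lf lg lh; rewrite innerprodC//; last exact: L2B.
by rewrite innerprodBl// (innerprodC lg lf) (innerprodC lh lf) rmorphB.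
Qed.

Lemma innerprodZr c f g : L2 f -> L2 g ->
  innerprod f (cstL c * g) = conjc c * innerprod f g.
Proof.
move=> lf lg; rewrite innerprodC//; last exact: L2Z.
by rewrite innerprodZl// (innerprodC lg lf) rmorphM.
Qed.

Lemma innerprod_eq0C f g : L2 f -> L2 g ->
  innerprod f g = 0 -> innerprod g f = 0.
Proof. by move=> lf lg fg; rewrite innerprodC// fg rmorph0. Qed.

Lemma N2_pythagoras f g : L2 f -> L2 g -> innerprod f g = 0 ->
  N2 (f + g) = N2 f + N2 g.
Proof.
move=> lf lg fg; have lfg := L2D lf lg.
have : innerprod (f + g) (f + g) = innerprod f f + innerprod g g.
  rewrite innerprodDl ?innerprodDr// fg (innerprod_eq0C lf lg fg).
  by rewrite addr0 add0r.
by rewrite !innerprodff// => /(congr1 (@complex.Re R)).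
Qed.

Lemma normc_innerprod_le f g (t : R) : 0 < t -> L2 f -> L2 g ->
  normc (innerprod f g) <= t * N2 f + t^-1 * N2 g.
Proof.
move=> t0 lf lg; apply: le_trans (normc_integralL (L2MJ lf lg)) _.
by rewrite -(N2_conj g); apply: N1M_le => //; exact: L2_conj.
Qed.

Lemma L2_zX n : L2 (@zL R ^+ n).
Proof. exact: Linfty_L2 (unimodular_Linfty (unimodular_zX _ n)). Qed.

Lemma L2_zcX n : L2 (conjL (@zL R) ^+ n).
Proof. exact: Linfty_L2 (unimodular_Linfty (unimodular_zcX _ n)). Qed.

Lemma zX_mulJ i j : (i <= j)%N ->
  @zL R ^+ i * conjL zL ^+ j = conjL zL ^+ (j - i).
Proof.
move=> ij; rewrite -{1}(subnK ij) exprD mulrCA -exprMn z_conjz expr1n.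
by rewrite mulr1.
Qed.

Lemma conjz_X n : conjL (@zL R ^+ n) = conjL zL ^+ n.
Proof. by rewrite rmorphXn. Qed.

Lemma integralL_zcX n : integralL (conjL (@zL R) ^+ n.+1) = 0.
Proof.
rewrite -conjz_X integralL_conj ?integralL_zX ?rmorph0//.
exact/L2_L1/L2_zX.
Qed.

Lemma innerprod_zz i j : innerprod (@zL R ^+ i) (zL ^+ j) = (i == j)%:R.
Proof.
have lt a b : (a < b)%N -> innerprod (@zL R ^+ a) (zL ^+ b) = 0.
  move=> ab; rewrite /innerprod conjz_X zX_mulJ ?(ltnW ab)//.
  by rewrite -(ltn_predK (_ : 0 < b - a))%N ?subn_gt0// integralL_zcX.
case: (ltngtP i j) => [ij|ij|->].
- by rewrite lt.
- by rewrite innerprodC ?lt ?rmorph0//; exact: L2_zX.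
- by rewrite /innerprod unimodular_zX integralL1.
Qed.

Definition zpoly (a : nat -> C) n : L0 := \sum_(0 <= i < n) cstL (a i) * zL ^+ i.

Lemma zpolyS a n : zpoly a n.+1 = zpoly a n + cstL (a n) * zL ^+ n.
Proof. by rewrite /zpoly big_nat_recr. Qed.

Lemma zpoly0 a : zpoly a 0 = 0.
Proof. by rewrite /zpoly big_nil. Qed.

Lemma L2_0 : L2 (0 : L0).
Proof. by rewrite -(rmorph0 (@cstL R)); exact/Linfty_L2/Linfty_cst. Qed.

Lemma L2_zpoly a n : L2 (zpoly a n).
Proof.
elim: n => [|n ih]; first by rewrite zpoly0; exact: L2_0.
by rewrite zpolyS; apply: L2D => //; apply/L2Z/L2_zX.
Qed.

Lemma innerprod0l f : innerprod 0 f = 0.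
Proof. by rewrite /innerprod mul0r integralL0. Qed.

Lemma innerprod0r f : innerprod f 0 = 0.
Proof. by rewrite /innerprod rmorph0 mulr0 integralL0. Qed.

Lemma innerprod_zpoly_z a n i :
  innerprod (zpoly a n) (zL ^+ i) = if (i < n)%N then a i else 0.
Proof.
elim: n => [|n ih]; first by rewrite zpoly0 innerprod0l.
rewrite zpolyS innerprodDl ?ih; [|exact: L2_zpoly|exact/L2Z/L2_zX|exact: L2_zX].
rewrite innerprodZl ?innerprod_zz ?ltnS; [|exact: L2_zX..].
by case: (ltngtP i n) => [?|?|->]; rewrite ?mulr0 ?addr0 ?add0r ?mulr1.
Qed.

Lemma innerprod_zpoly_r f a n : L2 f ->
  (forall i, (i < n)%N -> innerprod f (zL ^+ i) = 0) ->
  innerprod f (zpoly a n) = 0.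
Proof.
move=> lf; elim: n => [|n ih] h; first by rewrite zpoly0 innerprod0r.
rewrite zpolyS innerprodDr//; [|exact: L2_zpoly|exact/L2Z/L2_zX].
rewrite ih ?add0r => [|i ni]; last by rewrite h// ltnW.
by rewrite innerprodZr ?h ?mulr0//; exact: L2_zX.
Qed.

Lemma N2_cst c : N2 (cstL c : L0) = normc c ^+ 2.
Proof. by rewrite N2_class; exact: rint_cst. Qed.

Lemma N2_zpolyB a m n : (n <= m)%N ->
  N2 (zpoly a m - zpoly a n) = \sum_(n <= i < m) normc (a i) ^+ 2.
Proof.
elim: m => [|m ih].
  rewrite leqn0 => /eqP ->; rewrite subrr big_nil -(rmorph0 (@cstL R)) N2_cst.
  by rewrite normc0 expr0n.
rewrite leq_eqVlt => /predU1P[<-|nm].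
  rewrite subrr big_geq// -(rmorph0 (@cstL R)) N2_cst.
  by rewrite normc0 expr0n.
rewrite big_nat_recr//= -ih// zpolyS addrAC [LHS]N2_pythagoras.
- congr (_ + _); rewrite mulrC N2_umul ?N2_cst//; exact: unimodular_zX.
- by apply: L2B; exact: L2_zpoly.
- exact/L2Z/L2_zX.
rewrite innerprodZr; [|by apply: L2B; exact: L2_zpoly|exact: L2_zX].
rewrite innerprodBl; [|exact: L2_zpoly..|exact: L2_zX].
by rewrite !innerprod_zpoly_z ltnn ltnNge -ltnS nm subrr mulr0.
Qed.

Definition coef f n : C := innerprod f (zL ^+ n).

Lemma bessel f n : L2 f -> \sum_(0 <= i < n) normc (coef f i) ^+ 2 <= N2 f.
Proof.
move=> lf; have lS := L2_zpoly (coef f) n.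
have -> : N2 f = N2 (f - zpoly (coef f) n) + N2 (zpoly (coef f) n).
  rewrite -[in LHS](subrK (zpoly (coef f) n) f) [LHS]N2_pythagoras//.
    exact: L2B.
  apply: innerprod_zpoly_r => [|i ni]; first exact: L2B.
  rewrite innerprodBl//; last exact: L2_zX.
  by rewrite innerprod_zpoly_z ni subrr.
rewrite -(N2_zpolyB _ (leq0n n)) zpoly0 subr0 lerDr.
exact: N2_ge0.
Qed.

End InnerProduct.

(** * The space H2: density of polynomials, projection, and products *)

Section HardySpace.
Variable R : realType.
Local Notation C := R[i].
Local Notation L0 := (L0 R).
Implicit Types (f g h : L0) (c : C).

Lemma le0_of_halves (x c : R) m :
  (forall k, (m <= k)%N -> x <= c * 2^-1 ^+ k) -> x <= 0.
Proof.
move=> h; rewrite leNgt; apply/negP => x0.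
have cv : c * 2^-1 ^+ k @[k --> \oo] --> 0.
  rewrite -[X in _ --> X](mulr0 c); apply: cvgM; first exact: cvg_cst.
  by apply: cvg_expr; rewrite ger0_norm; lra.
have [N _ hN] := ((cvgr0Pnorm_lt _).1 cv) x x0.
have := h _ (leq_maxr N m); rewrite leNgt => /negP; apply.
exact: le_lt_trans (ler_norm _) (hN _ (leq_maxl N m)).
Qed.

Lemma H2_L2 f : H2 f -> L2 f.
Proof. by case. Qed.

Lemma H2D f g : H2 f -> H2 g -> H2 (f + g).
Proof.
move=> [lf cf] [lg cg]; split=> [|n]; first exact: L2D.
rewrite mulrDl integralLD ?cf ?cg ?addr0//; apply: L2M => //; exact: L2_zX.
Qed.

Lemma H2Z c f : H2 f -> H2 (cstL c * f).
Proof.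
move=> [lf cf]; split=> [|n]; first exact: L2Z.
rewrite -mulrA integralLZ ?cf ?mulr0//; apply: L2M => //; exact: L2_zX.
Qed.

Lemma H2N f : H2 f -> H2 (- f).
Proof.
by move=> hf; rewrite -mulN1r -cstLE1 -rmorphN/=; exact: H2Z.
Qed.

Lemma H2B f g : H2 f -> H2 g -> H2 (f - g).
Proof. by move=> hf /H2N; exact: H2D. Qed.

Lemma H2_zX n : H2 (@zL R ^+ n).
Proof.
split=> [|m]; first exact: L2_zX.
by rewrite -exprD addnS integralL_zX.
Qed.

Lemma H2_1 : H2 (1 : L0).
Proof. exact: (H2_zX 0). Qed.

Lemma H2_cst c : H2 (cstL c : L0).
Proof. by rewrite -[cstL c]mulr1; apply: H2Z H2_1. Qed.

Lemma H2_zpoly a n : H2 (zpoly a n : L0).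
Proof.
elim: n => [|n ih]; first by rewrite zpoly0 -(rmorph0 (@cstL R)); exact: H2_cst.
by rewrite zpolyS; apply: H2D => //; apply/H2Z/H2_zX.
Qed.

Lemma bounded_cvg_tail (b : nat -> R) (M : R) : (forall i, 0 <= b i) ->
  (forall n, \sum_(0 <= i < n) b i <= M) ->
  forall e, 0 < e -> exists n, forall m, (n <= m)%N -> \sum_(n <= i < m) b i <= e.
Proof.
move=> b0 bM e e0; pose s n := \sum_(0 <= i < n) b i.
have ns : {homo s : n m / (n <= m)%N >-> n <= m}.
  by apply/nondecreasing_seqP => n; rewrite /s big_nat_recr//= lerDl.
have cs : cvgn s.
  by apply: nondecreasing_is_cvgn => //; exists M => _ [n _ <-]; exact: bM.
have sl n : s n <= limn s by exact: nondecreasing_cvgn_le.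
have [N _ /(_ N (leqnn N)) /= hN] := ((cvgrPdist_le _ _).1 cs) e e0.
exists N => m Nm; have := sl m; rewrite /s (big_cat_nat (leq0n N) Nm)/= -/(s N).
by have := le_trans (ler_norm _) hN; lra.
Qed.

(** [G] is the orthogonal projection of f onto H2, built as the limit of partial sums of its
    analytic part; Bessel's inequality makes the tails small. *)
Lemma H2_partial_sums f : L2 f -> exists G (N : nat -> nat),
  [/\ H2 G, forall n, coef G n = coef f n &
      forall k, N2 (G - zpoly (coef f) (N k)) <= 4^-1 ^+ k].
Proof.
move=> lf.
have p4 k : 0 < 4^-1 ^+ k :> R by rewrite exprn_gt0// invr_gt0.
have T k := bounded_cvg_tail (fun i => sqr_ge0 (normc (coef f i)))
  (fun n => bessel n lf) (p4 k).
have [n0 Hn0] := choice T.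
(* The sum makes [N] monotone and at least [n0]; the summand k + 1 gives n < N k for k >= n, so that
   the n-th coefficient is already present in the k-th sum. *)
pose N k := (\sum_(j < k.+1) n0 j + k.+1)%N.
have N0 k : (n0 k <= N k)%N.
  by rewrite /N big_ord_recr /= -addnA addnCA leq_addr.
have Nk k : (k < N k)%N by rewrite /N leq_addl.
have Nmono k m : (k <= m)%N -> (N k <= N m)%N.
  elim: m => [|m ih]; first by rewrite leqn0 => /eqP ->.
  rewrite leq_eqVlt => /predU1P[->//|/ih h]; apply: leq_trans h _.
  by rewrite /N [X in (_ <= X + _)%N]big_ord_recr /= leq_add// leq_addr.
pose g k := zpoly (coef f) (N k).
have lg k : L2 (g k) by exact: L2_zpoly.
have cg k m : (k <= m)%N -> N2 (g m - g k) <= 4^-1 ^+ k.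
  move=> km; rewrite N2_zpolyB ?Nmono//.
  apply: le_trans (Hn0 k (N m) (leq_trans (N0 k) (Nmono _ _ km))).
  rewrite [leRHS](big_cat_nat (N0 k) (Nmono _ _ km))/= lerDr.
  by apply: sumr_ge0 => i _; rewrite sqr_ge0.
have [G [lG GE]] := L2_complete lg cg.
have lGg k : L2 (G - g k) by exact: L2B.
(* Coefficients pass to the limit, since [G] and [g k] differ by at most 2 / 2^k in L^1. *)
have lim u c m : unimodular u ->
    (forall k, (m <= k)%N -> integralL (g k * u) = c) -> integralL (G * u) = c.
  move=> uu gc; apply/eqP; rewrite -subr_eq0; apply/eqP/eq0_normc/eqP.
  rewrite eq_le normc_ge0 andbT.
  apply: (@le0_of_halves _ 2 m) => k mk.
  have lu := Linfty_L2 (unimodular_Linfty uu).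
  rewrite -(gc k mk) -integralLB; [|exact: L2M..].
  rewrite -mulrBl; apply: le_trans (normc_integralL (L2M (lGg k) lu)) _.
  by rewrite mulrC N1_umul//; exact: N1_le_half.
exists G, N; split=> //.
- split=> // n; apply: (lim _ _ 0%N); first exact: unimodular_zX.
  by move=> k _; exact: (H2_zpoly _ _).2.
- move=> n; rewrite /coef /innerprod conjz_X.
  apply: (lim _ _ n); first exact: unimodular_zcX.
  move=> k nk; have := innerprod_zpoly_z (coef f) (N k) n.
  by rewrite (leq_ltn_trans nk (Nk k)) /coef /innerprod !conjz_X.
Qed.

Lemma H2_coef_eq f g : H2 f -> H2 g -> (forall n, coef f n = coef g n) -> f = g.
Proof.
move=> hf hg fg; have [lfg cfg] := H2B hf hg.
have [lf _] := hf; have [lg _] := hg.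
apply/eqP; rewrite -subr_eq0; apply/eqP; apply: fourier_uniqueness.
have cJ n : integralL ((f - g) * conjL zL ^+ n) = 0.
  have := fg n => /eqP; rewrite -subr_eq0 /coef -innerprodBl//; last exact: L2_zX.
  by rewrite /innerprod conjz_X => /eqP.
split=> [|n]; first exact: L2_L1.
by split=> //; case: n => [|n //]; have := cJ 0%N; rewrite !expr0.
Qed.

Lemma H2_approx h : H2 h -> exists (N : nat -> nat),
  forall k, N2 (h - zpoly (coef h) (N k)) <= 4^-1 ^+ k.
Proof.
move=> hh; have [G [N [hG GE GN]]] := H2_partial_sums (H2_L2 hh).
by exists N => k; have := GN k; rewrite (H2_coef_eq hG hh GE).
Qed.

(** f is orthogonal to the polynomials that approximate h; the weight 2^-k turns the squared error
    4^-k into a bound of order 2^-k. *)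
Lemma H2_orthogonal f h : L2 f -> (forall n, coef f n = 0) -> H2 h ->
  innerprod f h = 0.
Proof.
move=> lf cf hh; have [N hN] := H2_approx hh; have lh := H2_L2 hh.
apply/eq0_normc/eqP; rewrite eq_le normc_ge0 andbT.
apply: (@le0_of_halves _ (N2 f + 1) 0%N) => k _.
set g := zpoly (coef h) (N k); have lg : L2 g := L2_zpoly _ _.
have -> : innerprod f h = innerprod f (h - g).
  rewrite innerprodBr// [X in _ - X]innerprod_zpoly_r ?subr0// => i _.
  exact: cf.
have p0 : 0 < 2^-1 ^+ k :> R by rewrite exprn_gt0.
apply: le_trans (normc_innerprod_le p0 lf (L2B lh lg)) _.
rewrite mulrDl mulrC lerD2l mul1r ler_pdivrMl//.
by have := hN k; rewrite exprV4.
Qed.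

Lemma H2_projection f : L2 f -> exists G, H2 G /\
  forall h, H2 h -> innerprod (f - G) h = 0.
Proof.
move=> lf; have [G [_ [hG GE _]]] := H2_partial_sums lf.
have lG := H2_L2 hG.
exists G; split=> // h; apply: H2_orthogonal; first exact: L2B.
by move=> n; rewrite /coef innerprodBl ?[X in _ - X]GE ?subrr//; exact: L2_zX.
Qed.

(** The bilinear form of the density of polynomials. It controls the coefficients of a product of
    two H2 functions, although the product is only known to lie in L^1. *)
Lemma H2M_orthogonal f h : L2 f -> (forall n, integralL (f * zL ^+ n) = 0) ->
  H2 h -> integralL (f * h) = 0.
Proof.
move=> lf cf hh; have lh := H2_L2 hh; have lfJ := L2_conj lf.
have : innerprod (conjL f) h = 0.
  apply: H2_orthogonal => // n.
  rewrite /coef /innerprod -rmorphM integralL_conj ?cf ?rmorph0//.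
  by apply: L2M => //; exact: L2_zX.
rewrite /innerprod -rmorphM integralL_conj; last exact: L2M.
by move/eqP; rewrite conjc_eq0 => /eqP.
Qed.

Lemma H2M_coef f h n : H2 f -> H2 h -> integralL (f * h * zL ^+ n.+1) = 0.
Proof.
move=> hf hh; rewrite mulrAC; apply: H2M_orthogonal => // [|m].
  by rewrite mulrC; apply: L2_umul (unimodular_zX _ _) (H2_L2 hf).
by rewrite -mulrA -exprD addSn (hf.2 (n + m)%N).
Qed.

(** The mean is evaluation at the origin: once it is subtracted, f has only coefficients of positive
    index, and its product with h has mean zero. *)
Lemma H2M_mean f h : H2 f -> H2 h ->
  integralL (f * h) = integralL f * integralL h.
Proof.
move=> hf hh; have lf := H2_L2 hf; have lh := H2_L2 hh.
set a := integralL f; have la : L2 (cstL a) := Linfty_L2 (Linfty_cst _).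
have : integralL ((f - cstL a) * h) = 0.
  apply: H2M_orthogonal => // [|[|n]]; first exact: L2B.
    by rewrite mulr1 integralLB ?integralL_cst ?subrr//; exact: L2_L1.
  rewrite mulrBl integralLB ?hf.2; [|apply: L2M => //; exact: L2_zX..].
  by rewrite integralLZ ?integralL_zX ?mulr0 ?subr0//; exact/L2_L1/L2_zX.
rewrite mulrBl integralLB; [|exact: L2M..].
by rewrite integralLZ; [move/eqP; rewrite subr_eq0 => /eqP|exact: L2_L1].
Qed.

Lemma H2_umul u f : unimodular u -> H2 u -> H2 f -> H2 (u * f).
Proof.
move=> uu hu hf; split=> [|n]; first exact: L2_umul uu (H2_L2 hf).
exact: H2M_coef.
Qed.

(** The backward shift moves the mean to index -1. *)
Lemma H2_divz f : H2 f -> integralL f = 0 -> H2 (conjL zL * f).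
Proof.
move=> [lf cf] f0; split=> [|n].
  by apply: L2_umul => //; exact/unimodular_conj/unimodular_z.
rewrite mulrAC exprS mulrA (mulrC (conjL zL)) z_conjz mul1r mulrC.
by case: n => [|n]; rewrite ?mulr1.
Qed.

End HardySpace.

(** * Boundary zeros of H2 functions *)

Section BoundaryUniqueness.
Variable R : realType.
Local Notation C := R[i].
Local Notation T := (circle R).
Local Notation L0 := (L0 R).
Local Notation mu := (@circle_measure R).
Implicit Types (f g h P Q : L0) (p : T -> R) (c : C).

(** The algebra H^infinity, presented inside H2 so that the lemmas on H2 apply; boundedness makes it
    closed under products. *)
Definition bounded_analytic P := Linfty P /\ H2 P.

Lemma bounded_analyticD P Q :
  bounded_analytic P -> bounded_analytic Q -> bounded_analytic (P + Q).
Proof. by move=> [? ?] [? ?]; split; [exact: LinftyD|exact: H2D]. Qed.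

Lemma bounded_analyticM P Q :
  bounded_analytic P -> bounded_analytic Q -> bounded_analytic (P * Q).
Proof.
move=> [lP hP] [lQ hQ]; split; first exact: LinftyM.
split=> [|n]; first exact: LinftyL2 lP (H2_L2 hQ).
exact: H2M_coef.
Qed.

Lemma bounded_analytic_cst c : bounded_analytic (cstL c).
Proof. by split; [exact: Linfty_cst|exact: H2_cst]. Qed.

Lemma bounded_analytic_z : bounded_analytic (@zL R).
Proof.
by split; [exact: unimodular_Linfty (unimodular_z R)|exact: (H2_zX R 1)].
Qed.

Lemma bounded_analytic_divz Q : bounded_analytic Q ->
  bounded_analytic (conjL zL * (Q - cstL (integralL Q))).
Proof.
move=> [lQ hQ].
have lc : Linfty (Q - cstL (integralL Q)).
  by rewrite -rmorphN; apply: LinftyD => //; exact: Linfty_cst.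
split.
  apply: LinftyM => //.
  exact: unimodular_Linfty (unimodular_conj (unimodular_z R)).
apply: H2_divz; first by apply: H2B => //; exact: H2_cst.
rewrite integralLB ?integralL_cst ?subrr//; first exact: L2_L1 (H2_L2 hQ).
exact: L2_L1 (H2_L2 (H2_cst _)).
Qed.

(** A space that contains the constants and is stable under z and conj z, hence contains every
    trigonometric polynomial. It serves to write a real one as the real part of a bounded analytic
    function. *)
Definition harmonic_sum f := exists P Q,
  [/\ bounded_analytic P, bounded_analytic Q & f = P + conjL Q].

Lemma harmonic_sumD f g :
  harmonic_sum f -> harmonic_sum g -> harmonic_sum (f + g).
Proof.
move=> [P [Q [hP hQ ->]]] [P' [Q' [hP' hQ' ->]]].
exists (P + P'), (Q + Q'); split; [exact: bounded_analyticD..|].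
by rewrite rmorphD/= addrACA.
Qed.

Lemma harmonic_sumZ c f : harmonic_sum f -> harmonic_sum (cstL c * f).
Proof.
move=> [P [Q [hP hQ ->]]].
exists (cstL c * P), (cstL (conjc c) * Q).
split; [exact: bounded_analyticM (bounded_analytic_cst _) _..|].
by rewrite rmorphM/= conjL_cst conjcK mulrDr.
Qed.

Lemma harmonic_sum_conj f : harmonic_sum f -> harmonic_sum (conjL f).
Proof.
move=> [P [Q [hP hQ ->]]]; exists Q, P; split => //.
by rewrite rmorphD/= conjLK addrC.
Qed.

Lemma harmonic_sumz f : harmonic_sum f -> harmonic_sum (zL * f).
Proof.
move=> [P [Q [hP hQ ->]]].
(* z conj Q is the conjugate of conj z Q, which is analytic except for the term conj z q; that term
   moves to the analytic part as conj q z. *)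
pose q := integralL Q; pose Q' := conjL zL * (Q - cstL q).
exists (zL * P + cstL (conjc q) * zL), Q'; split.
- apply: bounded_analyticD; apply: bounded_analyticM => //.
  + exact: bounded_analytic_z.
  + exact: bounded_analytic_cst.
  + exact: bounded_analytic_z.
- exact: bounded_analytic_divz.
- rewrite /Q' rmorphM rmorphB/= conjLK conjL_cst !mulrDr mulrN.
  by rewrite [cstL _ * zL]mulrC addrA addrAC addrK.
Qed.

Lemma harmonic_sumzc f : harmonic_sum f -> harmonic_sum (conjL zL * f).
Proof.
move=> /harmonic_sum_conj/harmonic_sumz/harmonic_sum_conj.
by rewrite rmorphM/= conjLK.
Qed.

Lemma harmonic_sum_rtrig p (mp : measurable_fun setT p) f :
  rtrig p -> harmonic_sum f -> harmonic_sum (realL mp * f).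
Proof.
move=> tp; elim: tp mp f => {p} [c|||p q tp ihp tq ihq|p q tp ihp tq ihq] mp f nf.
- by rewrite realL_cst; exact: harmonic_sumZ.
- rewrite realL_Re -mulrA; apply: harmonic_sumZ; rewrite mulrDl.
  by apply: harmonic_sumD; [exact: harmonic_sumz|exact: harmonic_sumzc].
- rewrite realL_Im -mulrA; apply: harmonic_sumZ.
  rewrite mulrBl -[X in _ - X]mul1r -mulNr -cstLE1 -rmorphN/=.
  apply: harmonic_sumD; first exact: harmonic_sumzc.
  exact/harmonic_sumZ/harmonic_sumz.
- rewrite (realLD (measurable_rtrig tp) (measurable_rtrig tq)) mulrDl.
  by apply: harmonic_sumD; [exact: ihp|exact: ihq].
- rewrite (realLM (measurable_rtrig tp) (measurable_rtrig tq)) -mulrA.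
  by apply: ihp; exact: ihq.
Qed.

(** If P + conj Q is real, adding its conjugate shows that its double is (P + Q) + conj (P + Q). *)
Lemma rtrig_real_part p (mp : measurable_fun setT p) : rtrig p -> exists W,
  bounded_analytic W /\ realL mp = cstL 2^-1 * (W + conjL W).
Proof.
move=> tp.
have : harmonic_sum (realL mp * 1).
  apply: harmonic_sum_rtrig => //; exists 1, 0; rewrite rmorph0 addr0; split=> //.
    by rewrite -cstLE1; exact: bounded_analytic_cst.
  by rewrite -(rmorph0 (@cstL R)); exact: bounded_analytic_cst.
rewrite mulr1 => -[P [Q [hP hQ E]]].
exists (P + Q); split; first exact: bounded_analyticD.
have rE : conjL (realL mp) = realL mp.
  by rewrite classL_conj; apply/classL_eqP/aeW => x; rewrite conjc_real.
have E2 : realL mp + realL mp = (P + Q) + conjL (P + Q).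
  by rewrite -{2}rE E !rmorphD/= conjLK [conjL P + Q]addrC addrACA
    [conjL Q + _]addrC.
rewrite -E2 -[X in X + X]mul1r -cstLE1 -mulrDl -rmorphD/= mulrA -rmorphM/=.
by rewrite mulVf ?cstLE1 ?mul1r// pnatr_eq0.
Qed.

Lemma normc_1DZ_le (s : R) (w : C) :
  normc (1 + s%:C * w) ^+ 2 <= expR (2 * (s * Re w) + s ^+ 2 * normc w ^+ 2).
Proof.
apply: le_trans (expR_ge1Dx _); rewrite !sqr_normcE; case: w => a b /=.
by rewrite !mul0r subr0 addr0 add0r; nra.
Qed.

(** Multiply 1 - t y <= exp (- t y) by exp (t y). The excess over 1 is linear in y, so off E it is
    controlled by the approximation error of the indicator. *)
Lemma expR_secant_le (t y : R) : 0 <= t -> 0 <= y <= 1 ->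
  expR (t * y) <= 1 + y * (t * expR t).
Proof.
move=> t0 /andP[y0 y1].
have h : expR (t * y) * (1 - t * y) <= 1.
  have := expR_ge1Dx (- (t * y)) => h1.
  apply: le_trans (_ : expR (t * y) * expR (- (t * y)) <= 1).
    by rewrite ler_wpM2l// expR_ge0.
  by rewrite -expRD subrr expR0.
have h2 : expR (t * y) <= expR t by rewrite ler_expR ler_piMr.
have := ler_wpM2l (mulr_ge0 t0 y0) h2; lra.
Qed.

Lemma bounded_analyticX P n : bounded_analytic P -> bounded_analytic (P ^+ n).
Proof.
move=> hP; elim: n => [|n ih].
  by rewrite expr0 -cstLE1; exact: bounded_analytic_cst.
by rewrite exprS; exact: bounded_analyticM.
Qed.

Lemma integralLX P n : bounded_analytic P ->
  integralL (P ^+ n) = integralL P ^+ n.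
Proof.
move=> hP; elim: n => [|n ih]; first by rewrite !expr0 integralL1.
by rewrite !exprS H2M_mean ?ih//; [exact: hP.2|exact: (bounded_analyticX n hP).2].
Qed.

Lemma normcX (z : C) n : normc (z ^+ n) = normc z ^+ n.
Proof.
by elim: n => [|n ih]; rewrite ?expr0 ?normc1// !exprS normcM ih.
Qed.

Lemma reprLX f n :
  {ae mu, forall x, reprL (f ^+ n) x = reprL f x ^+ n}.
Proof.
elim: n => [|n ih].
  rewrite expr0 -cstLE1; apply: filterS (reprL_class (cmeasurable_cst 1)) => x /=.
  by rewrite expr0 => ->.
rewrite exprS; apply: filterS2 ih (reprLM f (f ^+ n)) => x h1 /= h2.
by rewrite exprS -h1 -h2.
Qed.

Lemma ge0_rint_le_ae (u v : T -> R) : rintegrable u -> rintegrable v ->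
  (forall x, 0 <= u x) -> (forall x, 0 <= v x) ->
  {ae mu, forall x, u x <= v x} -> rint u <= rint v.
Proof.
move=> iu iv u0 v0 uv.
rewrite -lee_fin /rint /Rintegral !fineK; last first.
- exact: (integrable_fin_num measurableT iu).
- exact: (integrable_fin_num measurableT iv).
apply: ae_ge0_le_integral => //.
- by move=> x _; rewrite lee_fin.
- by apply/measurable_EFinP; exact: rintegrable_measurable.
- by move=> x _; rewrite lee_fin.
- by apply/measurable_EFinP; exact: rintegrable_measurable.
- by apply: filterS uv => x /= uvx _; rewrite lee_fin.
Qed.

Section ZeroSet.
Variables (g : L0) (E : set T) (t : R).
Hypotheses (hg : H2 g) (mE : measurable E) (t0 : 0 < t).
Hypothesis g0 : {ae mu, forall x, E x -> reprL g x = 0}.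
Let m : R := rint (\1_E : T -> R).
Hypothesis m0 : 0 < m.

(* The powers of [1 + t W / n] imitate [exp (t W)], where W is bounded analytic
   and Re W approximates the indicator of E: they are large in mean, but bounded
   in L^1 against g, which vanishes on E. *)
Lemma zero_set_mean_le :
  t * (m / 2) * normc (integralL g) <= expR 1 * (N1 g + 1).
Proof.
have lg := L2_L1 (H2_L2 hg).
pose K := t * expR t.
have K0 : 0 < K by rewrite mulr_gt0// expR_gt0.
(* The first bound keeps the mean of [p] at least m / 2; the second makes the error term [K * e] at
   most 1. *)
pose e := Num.min (m / 2) K^-1.
have e0 : 0 < e by rewrite lt_min divr_gt0//= invr_gt0.
(* The summand 1 serves the lower estimate of the mean of [p], and |g| the upper estimate of the
   integral against g. *)
pose w x := 1 + normc (reprL g x).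
have iw : rintegrable w by apply: rintegrableD => //; exact: rintegrable_cst.
have w0 x : 0 <= w x by rewrite addr_ge0// normc_ge0.
have [_ /(_ _ e0)[p [tp p01 pe]]] := approximable_measurable w0 iw mE.
have mp := measurable_rtrig tp.
pose q x := `|p x - \1_E x| * w x.
have iq : rintegrable q by exact: weight_rintegrable.
have q0 x : 0 <= q x by rewrite mulr_ge0.
have ip : rintegrable p.
  by apply: rintegrable_le (rintegrable_cst 1) => // x; have := p01 x;
    rewrite ler_norml; lra.
have iE : rintegrable (\1_E : T -> R).
  apply: rintegrable_le (rintegrable_cst 1) => [|x].
    exact: measurable_indicR.
  by have := indic_itv E x; rewrite ler_norml; lra.
have pm : m / 2 <= rint p.
  have : m <= rint p + rint q.
    rewrite /m -rintD//; apply: rint_le => //; first exact: rintegrableD.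
    move=> x; have := ler_norm (\1_E x - p x); rewrite distrC => h.
    have : `|p x - \1_E x| <= q x by rewrite ler_peMr// lerDl normc_ge0.
    lra.
  by have : e <= m / 2; [rewrite ge_min lexx|move: pe; rewrite -/q; lra].
have [W [hW pW]] := rtrig_real_part mp tp.
have [F [mF [B [WF FB]]]] := Linfty_repr hW.1.
have pF : {ae mu, forall x, p x = Re (F x)}.
  move: pW; rewrite WF classL_conj classLD classL_mulcst.
  move/classL_eqP; apply: filterS => x /=; rewrite !fctE => h.
  apply: (@complexI R); rewrite [LHS]h ReJ_add mulrC; congr (_ / _).
(* For such n the quadratic remainder of |1 + t W / (n + 1)|^(2 (n + 1)) contributes at most 1 to
   the exponent, whence the factor [expR 1]. *)
have [n nB] : exists n, t ^+ 2 * B ^+ 2 <= n.+1%:R.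
  exists (Num.truncn (t ^+ 2 * B ^+ 2)); apply: ltW; exact: truncnS_gt.
pose s := t / n.+1%:R.
have n0 : (n.+1%:R : R) != 0 by rewrite pnatr_eq0.
have s0 : 0 <= s by rewrite divr_ge0 ?ltW.
have sn : n.+1%:R * s = t by rewrite /s mulrC divfK.
pose V := 1 + cstL s%:C * W.
have hV : bounded_analytic V.
  apply: bounded_analyticD; first by rewrite -cstLE1; exact: bounded_analytic_cst.
  by apply: bounded_analyticM => //; exact: bounded_analytic_cst.
have hU := bounded_analyticX n.+1 hV.
have lower : t * (m / 2) <= normc (integralL (V ^+ n.+1)).
  rewrite integralLX// normcX.
  have RV : 1 + s * rint p <= normc (integralL V).
    apply: le_trans (le_trans (ler_norm _) (Re_le_normc _)).
    have -> : V = classL (cmeasurableD (cmeasurable_cst 1)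
        (cmeasurableM (cmeasurable_cst s%:C) mF)).
      by rewrite -classLD -classL_mulcst -WF /V -cstLE1.
    rewrite integralL_class /= -(rint_cst 1) -rintZ// -rintD//; last 2 first.
      exact: rintegrable_cst.
      exact: rintegrableZ.
    rewrite le_eqVlt; apply/orP; left; apply/eqP; apply: rint_ae.
    - apply: measurable_funD; first exact: measurable_cst.
      by apply: measurable_funM => //; exact: measurable_cst.
    - exact: (cmeasurableD (cmeasurable_cst 1)
        (cmeasurableM (cmeasurable_cst s%:C) mF)).1.
    - apply: filterS pF => x /= ->; rewrite !fctE.
      by case: (F x) => a b /=; rewrite mul0r subr0.
  have rp0 : 0 <= rint p by apply: rint_ge0 => x; case/andP: (p01 x).
  have sp0 : 0 <= s * rint p by rewrite mulr_ge0.
  have B1 := @bernoulli_le R (s * rint p) n.+1.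
  apply: le_trans (le_trans (B1 _) _); last 2 first.
  - by lra.
  - by rewrite ler_pXn2r// nnegrE ?normc_ge0//; lra.
  rewrite (mulrA n.+1%:R) sn; apply: le_trans (_ : t * rint p <= _).
    by rewrite ler_wpM2l// ltW.
  by rewrite lerDr.
have upper : normc (integralL (V ^+ n.+1 * g)) <= expR 1 * (N1 g + 1).
  have lUg : L1 (V ^+ n.+1 * g) by exact: LinftyL1 hU.1 lg.
  apply: le_trans (normc_integralL lUg) _.
  pose v x := expR 1 * (normc (reprL g x) + K * q x).
  have iv : rintegrable v.
    by apply: rintegrableZ; apply: rintegrableD => //; exact: rintegrableZ.
  apply: le_trans (_ : rint v <= _).
    apply: ge0_rint_le_ae => //; first by move=> x; exact: normc_ge0.
      move=> x; rewrite mulr_ge0 ?expR_ge0// addr_ge0 ?normc_ge0//.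
      by rewrite mulr_ge0// ltW.
    have VF : {ae mu, forall x, reprL V x = 1 + s%:C * F x}.
      have -> : V = classL (cmeasurableD (cmeasurable_cst 1)
        (cmeasurableM (cmeasurable_cst s%:C) mF)).
        by rewrite -classLD -classL_mulcst -WF /V -cstLE1.
      exact: reprL_class.
    have h1 := reprLX V n.+1; have h2 := reprLM (V ^+ n.+1) g.
    apply: filterS2 (filterI pF (filterI VF g0)) (filterI h1 h2).
    move=> x [/= px [Vx gx]] [Ux Ugx].
    rewrite Ugx Ux Vx normcM normcX.
    have /andP[p0 p1] := p01 x.
    have Ue : normc (1 + s%:C * F x) ^+ n.+1 <= expR (t * p x + 1).
      rewrite -(@ler_pXn2r _ 2)// ?nnegrE ?expR_ge0 ?exprn_ge0 ?normc_ge0//.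
      rewrite exprAC; apply: le_trans (_ : expR (2 * (s * Re (F x)) +
        s ^+ 2 * normc (F x) ^+ 2) ^+ n.+1 <= _).
        by rewrite ler_pXn2r ?nnegrE ?expR_ge0 ?sqr_ge0// normc_1DZ_le.
      rewrite -!expRM_natl ler_expR -px mulrDr.
      have -> : n.+1%:R * (2 * (s * p x)) = 2 * (t * p x) by rewrite -sn; ring.
      rewrite mulrDr lerD2l mulr1.
      have -> : n.+1%:R * (s ^+ 2 * normc (F x) ^+ 2) =
        s * t * normc (F x) ^+ 2 by rewrite -{1}sn; ring.
      have FB2 : normc (F x) ^+ 2 <= B ^+ 2.
        by rewrite ler_pXn2r// nnegrE ?normc_ge0// (le_trans (normc_ge0 _) (FB x)).
      apply: le_trans (_ : s * t * B ^+ 2 <= _).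
        by rewrite ler_wpM2l// mulr_ge0// ltW.
      have -> : s * t * B ^+ 2 = t ^+ 2 * B ^+ 2 / n.+1%:R.
        by rewrite /s; field.
      by rewrite ler_pdivrMr ?ltr0Sn//; move: nB; have := ltr0Sn R n; lra.
    have G0 := normc_ge0 (reprL g x).
    apply: le_trans (ler_wpM2r G0 Ue) _.
    rewrite /v expRD mulrC [expR _ * expR 1]mulrC mulrCA ler_wpM2l ?expR_ge0//.
    apply: le_trans (ler_wpM2l G0 (expR_secant_le (ltW t0) (p01 x))) _.
    rewrite mulrDr mulr1 lerD2l -/K mulrA mulrC ler_wpM2l ?(ltW K0)//.
    (* On E the factor g is zero; off E, p is itself the distance to the indicator. *)
    rewrite /q indicE; have [xE|xE] := boolP (x \in E).
      by rewrite gx ?normc0 ?mul0r ?mulr_ge0//; exact: set_mem.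
    rewrite subr0 ger0_norm// mulrC ler_wpM2l// /w lerDr//.
  rewrite rintZ ?ler_wpM2l ?expR_ge0//; last first.
    by apply: rintegrableD => //; exact: rintegrableZ.
  rewrite rintD//; last exact: rintegrableZ.
  rewrite lerD2l rintZ//.
  apply: le_trans (_ : K * e <= _); first by rewrite ler_wpM2l// ltW.
  apply: le_trans (_ : K * K^-1 <= _); last by rewrite divff// gt_eqF.
  by rewrite ler_wpM2l ?(ltW K0)// ge_min lexx orbT.
apply: le_trans upper; rewrite (H2M_mean hU.2 hg) normcM.
by rewrite ler_wpM2r// normc_ge0.
Qed.

End ZeroSet.

End BoundaryUniqueness.

(** * H2 functions that vanish on a set of positive measure *)

Section ZeroDivisors.
Variable R : realType.
Local Notation C := R[i].
Local Notation T := (circle R).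
Local Notation L0 := (L0 R).
Local Notation mu := (@circle_measure R).
Implicit Types (f g h : L0).

(** The right side of [zero_set_mean_le] does not depend on t, while the left side grows linearly
    unless the mean is zero; t is chosen so as to give c + 1 <= c. *)
Lemma zero_set_mean g (E : set T) : H2 g -> measurable E ->
  0 < rint (\1_E : T -> R) -> {ae mu, forall x, E x -> reprL g x = 0} ->
  integralL g = 0.
Proof.
move=> hg mE m0 g0; apply: eq0_normc; apply/eqP.
rewrite eq_le normc_ge0 andbT leNgt; apply/negP => X0.
set X := normc (integralL g) in X0; set m := rint _ in m0.
pose c := expR 1 * (N1 g + 1).
have c0 : 0 <= c by rewrite mulr_ge0 ?expR_ge0// addr_ge0 ?N1_ge0.
pose d := m / 2 * X; have d0 : 0 < d by rewrite !mulr_gt0// invr_gt0.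
have t0 : 0 < (c + 1) / d by rewrite divr_gt0// ltr_wpDl.
have := zero_set_mean_le hg mE t0 g0 m0.
rewrite -/m -/X -/c -mulrA -/d divfK ?gt_eqF//; lra.
Qed.

(** A zero mean permits division by z, the quotient still vanishes on E, and so all coefficients
    vanish in turn. *)
Lemma H2_zero_set g (E : set T) : H2 g -> measurable E ->
  0 < rint (\1_E : T -> R) -> {ae mu, forall x, E x -> reprL g x = 0} ->
  g = 0.
Proof.
move=> hg mE m0 g0.
have G n : H2 (conjL zL ^+ n * g) /\ integralL (conjL zL ^+ n * g) = 0.
  elim: n => [|n [ih1 ih2]].
    by rewrite expr0 mul1r; split => //; exact: zero_set_mean g0.
  have h : H2 (conjL zL ^+ n.+1 * g) by rewrite exprS -mulrA; exact: H2_divz.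
  split => //; apply: zero_set_mean (mE) m0 _ => //.
  apply: filterS2 g0 (reprLM (conjL zL ^+ n.+1) g) => x /= gx -> Ex.
  by rewrite gx// mulr0.
apply: H2_coef_eq => // [|n].
  by rewrite -(rmorph0 (@cstL R)); exact: H2_cst.
by rewrite /coef innerprod0l /innerprod conjz_X mulrC (G n).2.
Qed.

Lemma H2_mulf_eq0 g h : H2 g -> h * g = 0 -> g = 0 \/ h = 0.
Proof.
move=> hg hg0; pose E := [set x | 0 < normc (reprL h x)].
have mE : measurable E.
  have -> : E = setT `&` (fun x => normc (reprL h x)) @^-1` `]0, +oo[.
    by apply/seteqP; split=> x /=; rewrite in_itv /E /= andbT// => -[].
  exact: measurable_normc (cmeasurable_reprL h) _ _ _.
have m0 : 0 <= rint (\1_E : T -> R).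
  by apply: rint_ge0 => x; case/andP: (indic_itv E x).
have [m1|m1] := ltP 0 (rint (\1_E : T -> R)).
  left; apply: (H2_zero_set hg mE m1).
  have /L0_eqP := hg0; apply: filterS2 (filterI (reprLM h g)
    (reprL_class (@cmeasurable_cst R 0))) => x [/= -> z0].
  rewrite -(rmorph0 (@cstL R)) z0 /E/= => /eqP; rewrite mulf_eq0 => /orP[]/eqP//.
  by move=> ->; rewrite normc0 ltxx.
right; pose mI := @measurable_indicR R E mE.
have lI : Linfty (realL mI).
  apply: (@Linfty_class _ _ _ 1) => x.
  by rewrite normcR ger0_norm; have := indic_itv E x => /andP[].
have I0 : realL mI = 0.
  apply: N2_eq0; first exact: Linfty_L2.
  apply/eqP; rewrite eq_le N2_ge0 andbT; apply: le_trans m1.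
  rewrite N2_class le_eqVlt; apply/orP; left; apply/eqP; congr rint.
  apply/funext => x; rewrite normcR indicE.
  by case: (_ \in _); rewrite ?normr1 ?normr0 ?expr1n ?expr0n.
have <- : realL mI * h = h; last by rewrite I0 mul0r.
apply/L0_eqP; apply: filterS2 (reprLM (realL mI) h)
  (reprL_class (cmeasurable_real mI)) => x /= -> ->.
rewrite indicE; have [xE|xE] := boolP (x \in E); first by rewrite mul1r.
rewrite mul0r; apply/esym/eq0_normc/eqP; rewrite eq_le normc_ge0 andbT leNgt.
by apply: contra xE => h0; exact: mem_set.
Qed.

End ZeroDivisors.

(** * Model spaces *)

Section CommutativeIdentities.
Variable A : comNzRingType.
Implicit Types a b c d t : A.

Lemma mulr_unitCA a b c d t : a * b = 1 -> t * (b * c) * (a * d) = t * d * c.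
Proof. by move=> ab; rewrite -[RHS]mul1r -ab; ring. Qed.

Lemma mulr_kernelE a b c d t :
  a * (1 - b * c) * d * t = a * d * t - b * (a * (c * d) * t).
Proof. by ring. Qed.

Lemma mulr_rotate4 a b c d : a * b * (c * d) = c * a * b * d.
Proof. by ring. Qed.

Lemma mulr_pair a b c d t : a * b * c * (d * t) = d * b * ((c * t) * a).
Proof. by ring. Qed.

Lemma mulr_move_unit a b c d : a * b = 1 -> c * (b * d) = a * (c * b * b * d).
Proof. by move=> ab; rewrite -[LHS]mul1r -ab; ring. Qed.

End CommutativeIdentities.

Section ModelSpaces.
Variable R : realType.
Local Notation C := R[i].
Local Notation L0 := (L0 R).
Implicit Types (f g h k alpha beta theta psi u : L0) (c : C).

(** The symbol is J 1, and J z^n = conj z^n psi for all integers n. Isometry against these shows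
    that J f conj psi and conj f have the same Fourier coefficients; the case f = 1 says that psi is
    unimodular. *)
Lemma conjugation_zE (J : L0 -> L0) : conjugation_on L2 J ->
  (forall f, L2 f -> mulop zL (J f) = J (mulop (conjL zL) f)) ->
  exists psi, unimodular psi /\ forall f, L2 f -> J f = psi * conjL f.
Proof.
move=> [J2 _ _ JI] Jz; pose psi := J 1; have l1 := @L2_1 R.
have lpsi : L2 psi by exact: J2.
have Jzc n : J (conjL zL ^+ n) = zL ^+ n * psi.
  elim: n => [|n ih]; first by rewrite !expr0 mul1r.
  rewrite !exprS -mulrA -ih; apply/esym; apply: Jz; exact: L2_zcX.
have Jzz n : J (zL ^+ n) = conjL zL ^+ n * psi.
  elim: n => [|n ih]; first by rewrite !expr0 mul1r.
  have := Jz _ (L2_zX R n.+1); rewrite /mulop exprS mulrA.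
  rewrite [conjL zL * zL]mulrC z_conjz mul1r ih => h.
  rewrite !exprS -[RHS]mulrA -h mulrA [conjL zL * zL]mulrC z_conjz.
  by rewrite mul1r.
have key f : L2 f -> J f * conjL psi = conjL f.
  move=> lf; apply/eqP; rewrite -subr_eq0; apply/eqP/fourier_uniqueness.
  have lJ := J2 _ lf; have lfJ := L2_conj lf.
  have l1J := L2MJ lJ lpsi.
  have lc := L2_L1 lfJ.
  split=> [|n]; first exact: L1B.
  split; rewrite mulrBl integralLB.
  - have := JI _ _ lf (L2_zX R n).
    rewrite Jzz /innerprod rmorphM -conjz_X /= conjLK mulrCA [_ * zL ^+ n]mulrC.
    by rewrite [_ ^+ n * _]mulrC [_ ^+ n * _]mulrC => ->; rewrite subrr.
  - by rewrite mulrC; exact: L1_umul (unimodular_zX _ _) _.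
  - by rewrite mulrC; exact: L1_umul (unimodular_zX _ _) _.
  - have := JI _ _ lf (L2_zcX R n).
    rewrite Jzc /innerprod rmorphM /= conjz_X mulrCA.
    by rewrite [_ ^+ n * _]mulrC [_ ^+ n * _]mulrC => ->; rewrite subrr.
  - by rewrite mulrC; exact: L1_umul (unimodular_zcX _ _) _.
  - by rewrite mulrC; exact: L1_umul (unimodular_zcX _ _) _.
have upsi : unimodular psi by have := key _ l1; rewrite conjL1.
exists psi; split => // f lf; rewrite -(key _ lf) mulrCA.
by rewrite (upsi : psi * conjL psi = 1) mulr1.
Qed.

Definition inner_H2 u := unimodular u /\ H2 u.

Lemma inner_functionP u : inner_function u -> inner_H2 u.
Proof.
move=> [[bu cu] /unimodularP uu]; split=> //; split=> //.
exact: Linfty_L2.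
Qed.

Lemma inner_H2_mul u f : inner_H2 u -> H2 f -> H2 (u * f).
Proof. by move=> [uu hu]; exact: H2_umul. Qed.

Lemma model_spaceP theta f : model_space theta f <->
  H2 f /\ forall k, H2 k -> innerprod f (theta * k) = 0.
Proof.
split=> -[hf fo]; split=> // k hk; first by apply: fo; exists k.
by case: hk => h hh <-; exact: fo.
Qed.

Lemma model_space_H2 theta f : model_space theta f -> H2 f.
Proof. by case. Qed.

Lemma model_space_L2 theta f : model_space theta f -> L2 f.
Proof. by move=> /model_space_H2/H2_L2. Qed.

Lemma innerprod_umul u f g : unimodular u ->
  innerprod (u * f) (u * g) = innerprod f g.
Proof.
by move=> uu; rewrite /innerprod rmorphM/= mulrACA (uu : _ = 1) mul1r.
Qed.

Lemma unimodularK u f : unimodular u -> u * (conjL u * f) = f.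
Proof. by move=> uu; rewrite mulrA (uu : _ = 1) mul1r. Qed.

Lemma unimodularKJ u f : unimodular u -> conjL u * (u * f) = f.
Proof. by move=> uu; rewrite mulrCA unimodularK. Qed.

(** The two defining conditions are exchanged: orthogonality of f to theta z^n kills the coefficient
    of index -(n + 1) of the image, and analyticity of f k makes the image orthogonal to theta k. *)
Lemma C_model_space theta f : inner_H2 theta ->
  model_space theta f -> model_space theta (C_ theta f).
Proof.
move=> [ut ht] /model_spaceP[hf fo]; have lf := H2_L2 hf.
have uz := unimodular_z R.
have CE : C_ theta f = theta * (conjL (zL * f)) by rewrite rmorphM/= mulrA.
have lzf : L2 (zL * f) by exact: L2_umul.
apply/model_spaceP; split; first split.
- by rewrite CE; apply: L2_umul => //; exact: L2_conj.
- move=> n; have := fo _ (H2_zX R n).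
  move/(innerprod_eq0C lf (L2_umul ut (L2_zX _ _))).
  rewrite /innerprod CE rmorphM/= exprS => <-; congr integralL.
  exact: mulr_unitCA (z_conjz R).
- move=> k hk; have lk := H2_L2 hk; rewrite CE innerprod_umul//.
  rewrite /innerprod -rmorphM integralL_conj; last exact: L2M.
  by rewrite -mulrA mulrC (H2M_coef 0 hf hk) rmorph0.
Qed.
Lemma model_space_sub alpha beta f : inner_H2 beta ->
  model_space alpha f -> model_space (alpha * beta) f.
Proof.
move=> ib /model_spaceP[hf fo]; apply/model_spaceP; split=> // k hk.
by rewrite -mulrA; apply: fo; exact: inner_H2_mul.
Qed.

Lemma model_space_mul alpha beta f : inner_H2 alpha ->
  model_space beta f -> model_space (alpha * beta) (alpha * f).
Proof.
move=> ia /model_spaceP[hf fo]; apply/model_spaceP.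
split=> [|k hk]; first exact: inner_H2_mul.
by rewrite -mulrA innerprod_umul ?fo//; case: ia.
Qed.

Lemma model_space_orthogonal alpha f g : inner_H2 alpha -> H2 f ->
  model_space alpha g -> innerprod (alpha * f) g = 0.
Proof.
move=> [ua ha] hf kg; have lg := model_space_L2 kg.
have /model_spaceP[_ /(_ _ hf)] := kg.
by apply: innerprod_eq0C => //; exact: L2_umul ua (H2_L2 hf).
Qed.

(** [F] is the projection of conj alpha g onto H2, so g - alpha F is orthogonal to alpha H2. Pairing
    [F] with beta k amounts to pairing alpha F with alpha beta k, to which both g and g - alpha F
    are orthogonal. *)
Lemma model_space_split alpha beta g : inner_H2 alpha -> inner_H2 beta ->
  model_space (alpha * beta) g -> exists g1 F,
  [/\ model_space alpha g1, model_space beta F & g = g1 + alpha * F].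
Proof.
move=> ia ib kg; have /model_spaceP[hg go] := kg; have lg := H2_L2 hg.
have ua := ia.1; have uaJ := unimodular_conj ua.
have [F [hF Fo]] := H2_projection (L2_umul uaJ lg).
have laF := L2_umul ua (H2_L2 hF).
have k1 : model_space alpha (g - alpha * F).
  apply/model_spaceP; split=> [|k hk].
    by apply: H2B => //; exact: inner_H2_mul.
  rewrite -(innerprod_umul _ _ uaJ) unimodularKJ// mulrBr unimodularKJ//.
  exact: Fo.
exists (g - alpha * F), F; split=> //; last by rewrite subrK.
apply/model_spaceP; split=> // k hk.
have hbk := inner_H2_mul ib hk; have labk := L2_umul ua (H2_L2 hbk).
rewrite -(innerprod_umul _ _ ua).
rewrite -[alpha * F](subKr g) innerprodBl//; last exact: model_space_L2 k1.
have /model_spaceP[_ /(_ _ hbk) ->] := k1.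
by rewrite mulrA go// subr0.
Qed.

Lemma model_space_orthominus alpha beta g : inner_H2 alpha -> inner_H2 beta ->
  orthominus (model_space (alpha * beta)) (model_space alpha) g ->
  exists2 F, model_space beta F & g = alpha * F.
Proof.
move=> ia ib [kg gm]; have [g1 [F [k1 kF gE]]] := model_space_split ia ib kg.
exists F => //; suff g10 : g1 = 0 by rewrite gE g10 add0r.
have l1 := model_space_L2 k1; have hF := model_space_H2 kF.
apply: N2_eq0 => //; have := gm _ k1.
rewrite gE innerprodDl//; last exact: L2_umul ia.1 (H2_L2 hF).
rewrite (model_space_orthogonal ia hF k1) addr0 innerprodff//.
by move=> /(congr1 (@complex.Re R)).
Qed.

(** f = beta (conj c f) belongs to beta H2, so it is orthogonal to itself. *)
Lemma model_space_constant beta f : inner_H2 beta -> constantL beta ->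
  model_space beta f -> f = 0.
Proof.
move=> [ub hb] [c bc] /model_spaceP[hf fo]; have lf := H2_L2 hf.
have := fo _ (H2Z (conjc c) hf).
rewrite -conjL_cst -bc unimodularK// innerprodff// => /(congr1 (@complex.Re R)).
exact: N2_eq0.
Qed.

End ModelSpaces.

(** * Maps psi conj f that preserve a model space *)

Section ModelSpaceSymmetries.
Variable R : realType.
Local Notation C := R[i].
Local Notation L0 := (L0 R).
Implicit Types (f g h k alpha beta theta psi u v : L0) (c : C).

(** By Pythagoras, 1 is the squared modulus of the mean plus the squared distance from theta to its
    mean, which is positive unless theta is constant. *)
Lemma inner_mean_lt1 theta : inner_H2 theta -> ~ constantL theta ->
  normc (integralL theta) < 1.
Proof.
move=> [ut ht] nct; set a := integralL theta; have lt := H2_L2 ht.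
have la : L2 (cstL a) := H2_L2 (H2_cst a).
have N1t : N2 theta = 1 by rewrite -[theta]mulr1 N2_umul// N2_1.
have o : innerprod (theta - cstL a) (cstL a) = 0.
  rewrite -[X in innerprod _ X]mulr1 innerprodZr; [|exact: L2B|exact: L2_1].
  rewrite /innerprod conjL1 mulr1 integralLB ?integralL_cst ?subrr ?mulr0//;
    exact: L2_L1.
have := N2_pythagoras (L2B lt la) la o; rewrite subrK N1t N2_cst => E.
have d0 : 0 < N2 (theta - cstL a).
  rewrite lt_def N2_ge0 andbT; apply/eqP => h; apply: nct; exists a.
  by apply/eqP; rewrite -subr_eq0; apply/eqP; apply: N2_eq0 => //; exact: L2B.
rewrite ltNge; apply/negP => a1.
have : 1 <= normc a ^+ 2 by rewrite exprn_ege1.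
by lra.
Qed.

(* The reproducing kernel of the model space at the origin. *)
Definition kernel0 theta := 1 - cstL (conjc (integralL theta)) * theta.

Lemma kernel0_model_space theta : inner_H2 theta ->
  model_space theta (kernel0 theta).
Proof.
move=> [ut ht]; have lt := H2_L2 ht; apply/model_spaceP; split=> [|k hk].
  by apply: H2B (H2_1 R) _; exact: H2Z.
have lk := H2_L2 hk; have ltk := L2_umul ut lk.
rewrite /kernel0 innerprodBl//; [|exact: L2_1|exact: L2Z].
rewrite innerprodZl// -[X in conjc _ * innerprod X _]mulr1 innerprod_umul//.
rewrite /innerprod !mul1r !integralL_conj ?H2M_mean ?rmorphM ?subrr//;
  exact: L2_L1.
Qed.

Lemma le0_of_geometric (x r : R) : 0 <= r < 1 -> (forall n, x <= r ^+ n) ->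
  x <= 0.
Proof.
move=> /andP[r0 r1] xr; rewrite leNgt; apply/negP => x0.
have cv : r ^+ n @[n --> \oo] --> 0 by apply: cvg_expr; rewrite ger0_norm.
have [N _ hN] := ((cvgr0Pnorm_lt _).1 cv) x x0.
have := xr N; rewrite leNgt => /negP; apply.
exact: le_lt_trans (ler_norm _) (hN _ (leqnn N)).
Qed.

(* Expanding the inverse of the kernel into a geometric series shows that it
   does not affect analyticity. *)
Lemma H2_of_kernel0 theta v : inner_H2 theta -> ~ constantL theta ->
  unimodular v -> H2 (v * kernel0 theta) -> H2 v.
Proof.
move=> it nct uv hv; have [ut ht] := it.
have lv := Linfty_L2 (unimodular_Linfty uv).
split=> // n; set a := integralL theta; set z := zL ^+ n.+1.
have uz : unimodular z := unimodular_zX R n.+1.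
have uX m : unimodular (theta ^+ m) := unimodularX m ut.
have hX m : H2 (theta ^+ m).
  by elim: m => [|m ih]; [exact: H2_1|rewrite exprS; exact: inner_H2_mul].
(* Analyticity of v k theta^m, with k the kernel, gives I m = conj a * I (m + 1). As |I m| <= 1,
   this bounds |I 0| by |a|^m for every m. *)
pose I m := integralL (v * theta ^+ m * z).
have IS m : I m = conjc a * I m.+1.
  have l m' : L1 (v * theta ^+ m' * z).
    apply: L2_L1; apply: Linfty_L2; apply: unimodular_Linfty.
    by apply: unimodularM => //; exact: unimodularM.
  have := H2M_coef n hv (hX m); rewrite -/z.
  have -> : v * kernel0 theta * theta ^+ m * z =
      v * theta ^+ m * z - cstL (conjc a) * (v * theta ^+ m.+1 * z).
    by rewrite /kernel0 exprS; exact: mulr_kernelE.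
  rewrite integralLB// ?integralLZ//; last exact: L1Z.
  by move/eqP; rewrite subr_eq0 => /eqP.
have IE m : I 0%N = conjc a ^+ m * I m.
  by elim: m => [|m ->]; rewrite ?mul1r// exprSr -mulrA -IS.
rewrite -[LHS]/(integralL (v * z)) -[v]mulr1 -[1](expr0 theta) -/(I 0%N).
apply: eq0_normc; apply/eqP; rewrite eq_le normc_ge0 andbT.
have a1 := inner_mean_lt1 it nct.
apply: (@le0_of_geometric _ (normc a)) => [|m]; first by rewrite normc_ge0.
rewrite (IE m) normcM normcX normc_conjc ler_piMr// ?exprn_ge0 ?normc_ge0//.
have uI : unimodular (v * theta ^+ m * z).
  by apply: unimodularM => //; exact: unimodularM.
have lI := L2_L1 (Linfty_L2 (unimodular_Linfty uI)).
by apply: le_trans (normc_integralL lI) _; rewrite N1_unimodular.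
Qed.

Lemma H2_conj_constant u : H2 u -> H2 (conjL u) -> u = cstL (integralL u).
Proof.
move=> hu huJ; have lu := H2_L2 hu; have l1 := L2_L1 lu.
set a := integralL u; have hc := H2_cst a.
have lc := H2_L2 hc.
apply/eqP; rewrite -subr_eq0; apply/eqP; apply: fourier_uniqueness.
have m0 : integralL (u - cstL a) = 0.
  by rewrite integralLB ?integralL_cst ?subrr//; exact: L2_L1.
split=> [|[|n]]; first exact/L2_L1/L2B.
  by rewrite !expr0 mulr1.
split; first exact: (H2B hu hc).2.
have hcJ : H2 (conjL (u - cstL a)).
  by rewrite rmorphB/= conjL_cst; apply: H2B => //; exact: H2_cst.
have lB : L2 (u - cstL a) by exact: L2B.
have : integralL (conjL ((u - cstL a) * conjL zL ^+ n.+1)) = 0.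
  by rewrite rmorphM rmorphXn/= conjLK; exact: hcJ.2.
rewrite integralL_conj; last by apply: L2M => //; exact: L2_zcX.
by move/eqP; rewrite conjc_eq0 => /eqP.
Qed.

Lemma model_space_conj_multiplier theta psi :
  inner_H2 theta -> ~ constantL theta -> unimodular psi ->
  (forall f, model_space theta f -> model_space theta (psi * conjL f)) ->
  exists c, `|c| = 1 /\ psi = cstL c * (theta * conjL zL).
Proof.
move=> it nct up pK; have [ut ht] := it; have uz := unimodular_z R.
pose u := psi * conjL theta * zL.
have uu : unimodular u.
  by do 2 apply: unimodularM => //; exact: unimodular_conj.
have kK := kernel0_model_space it.
(* The given map after [C_ theta] is multiplication by u, and [C_ theta] after the given map is
   multiplication by conj u. *)
have hu : H2 u.
  apply: (H2_of_kernel0 it nct uu); apply: model_space_H2 (theta) _ _.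
  have := pK _ (C_model_space it kK).
  by rewrite /C_ !rmorphM/= !conjLK /u !mulrA.
have huJ : H2 (conjL u).
  apply: (H2_of_kernel0 it nct (unimodular_conj uu)).
  apply: model_space_H2 (theta) _ _.
  have := C_model_space it (pK _ kK); rewrite /C_ /u !rmorphM/= !conjLK.
  by congr (model_space theta _); exact: mulr_rotate4.
have uE := H2_conj_constant hu huJ; set c := integralL u in uE.
exists c; split.
  apply/normc_eq1; move: uu; rewrite /unimodular uE conjL_cst -rmorphM/=.
  by move/(congr1 (@integralL R)); rewrite integralL_cst integralL1.
rewrite -uE /u; have -> : psi * conjL theta * zL * (theta * conjL zL) =
  (theta * conjL theta) * ((zL * conjL zL) * psi) by exact: mulr_pair.
by rewrite (ut : _ = 1) (uz : _ = 1) !mul1r.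
Qed.

End ModelSpaceSymmetries.

(** * The alternative between equal and different symbols *)

Theorem theorem4p7 (R : realType) (alpha theta : L0 R)
    (Ct C1 C2 : L0 R -> L0 R) :
  inner_function alpha -> ~ constantL alpha ->
  inner_function theta -> ~ constantL theta ->
  inner_le alpha theta ->
  conjugation_on (model_space theta) Ct ->
  conjugation_on L2 C1 -> conjugation_on L2 C2 ->
  (forall f, L2 f -> mulop zL (C1 f) = C1 (mulop (conjL zL) f)) ->
  (forall f, L2 f -> mulop zL (C2 f) = C2 (mulop (conjL zL) f)) ->
  (forall f, model_space alpha f -> Ct f = C1 f) ->
  (forall f, orthominus (model_space theta) (model_space alpha) f ->
     Ct f = C2 f) ->
  (exists c : R[i], `|c| = 1 /\
     forall f, model_space theta f -> Ct f = cstL c * C_ theta f) \/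
  (exists c1 c2 : R[i], `|c1| = 1 /\ `|c2| = 1 /\
     forall f1 f2, model_space alpha f1 ->
       model_space (divL theta alpha) f2 ->
       Ct (f1 + alpha * f2) =
         cstL c1 * C_ alpha f1 +
         cstL c2 * (alpha * C_ (divL theta alpha) f2)).
Proof.
move=> /inner_functionP ia ncA /inner_functionP it ncT /inner_functionP ib.
move=> [CtK CtL CtI CtP] cC1 cC2 C1z C2z CtC1 CtC2.
have [psi1 [u1 C1E]] := conjugation_zE cC1 C1z.
have [psi2 [u2 C2E]] := conjugation_zE cC2 C2z.
have ua := ia.1; have uaJ := unimodular_conj ua.
set beta := divL theta alpha in ib *.
have tE : theta = alpha * beta by rewrite /beta divLE// mulrCA ua mulr1.
have subA f : model_space alpha f -> model_space theta f.
  by rewrite tE; exact: model_space_sub.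
have mulB f : model_space beta f -> model_space theta (alpha * f).
  by rewrite tE; exact: model_space_mul.
have Ct1 f : model_space alpha f -> Ct f = psi1 * conjL f.
  by move=> kf; rewrite CtC1// C1E//; exact: model_space_L2 kf.
have Ct2 f : model_space beta f -> Ct (alpha * f) = psi2 * conjL (alpha * f).
  move=> kf; rewrite CtC2 ?C2E//; first exact: L2_umul ua (model_space_L2 kf).
  split=> [|g kg]; first exact: mulB.
  exact: model_space_orthogonal ia (model_space_H2 kf) kg.
have CtD f g : model_space theta f -> model_space theta g ->
    Ct (f + g) = Ct f + Ct g.
  by move=> kf kg; have := CtL 1 1 f g kf kg; rewrite conjc1 cstLE1 !mul1r.
have CtS f1 f2 : model_space alpha f1 -> model_space beta f2 ->
    Ct (f1 + alpha * f2) = psi1 * conjL f1 + psi2 * conjL (alpha * f2).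
  by move=> k1 k2; rewrite (CtD _ _ (subA _ k1) (mulB _ k2)) Ct1// Ct2.
have [psiE|psiN] := pselect (psi1 = psi2).
  left.
  have CtE f : model_space theta f -> Ct f = psi1 * conjL f.
    rewrite {1}tE => /(model_space_split ia ib)[g1 [F [k1 kF ->]]].
    by rewrite CtS// -psiE -mulrDr -rmorphD.
  have [|c [c1 cE]] := model_space_conj_multiplier it ncT u1.
    by move=> f kf; rewrite -CtE//; exact: CtK.
  by exists c; split=> // f kf; rewrite CtE// cE -mulrA.
right.
have stabA f : model_space alpha f -> model_space alpha (psi1 * conjL f).
  move=> kf; have := CtK _ (subA _ kf); rewrite Ct1// {1}tE.
  move=> /(model_space_split ia ib)[g1 [F [k1 kF gE]]].
  have := CtI _ (subA _ kf); rewrite (Ct1 _ kf) gE CtS// => fE.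
  have fE' : psi1 * conjL (g1 + alpha * F) = f.
    by rewrite -gE rmorphM/= conjLK unimodularK.
  (* Both psi1 conj g1 + psi2 conj (alpha F) and psi1 conj (g1 + alpha F) equal f: the former is
     [Ct (Ct f)], the latter holds because [Ct f] is psi1 conj f. *)
  have : conjL (psi2 - psi1) * (alpha * F) = 0.
    rewrite -[alpha * F]conjLK -rmorphM -(rmorph0 (@conjL R)); congr conjL.
    rewrite mulrBl; apply/eqP; rewrite subr_eq0; apply/eqP.
    by apply: (addrI (psi1 * conjL g1)); rewrite fE -mulrDr -rmorphD fE'.
  move/(H2_mulf_eq0 (inner_H2_mul ia (model_space_H2 kF))) => [->|d0].
    by rewrite addr0.
  exfalso; apply: psiN; apply/esym/eqP; rewrite -subr_eq0; apply/eqP.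
  by rewrite -[LHS]conjLK d0 rmorph0.
have [c1 [c11 psi1E]] := model_space_conj_multiplier ia ncA u1 stabA.
(* Transported from alpha K_beta to K_beta, the map psi2 conj becomes psi conj: one conj alpha comes
   from the argument, the other from factoring alpha out. *)
pose psi := psi2 * conjL alpha * conjL alpha.
have up : unimodular psi by apply: unimodularM => //; exact: unimodularM.
have psi2E f : psi2 * conjL (alpha * f) = alpha * (psi * conjL f).
  by rewrite rmorphM; exact: mulr_move_unit ua.
have stabB f : model_space beta f -> model_space beta (psi * conjL f).
  move=> kf; have kaf := mulB _ kf.
  have : orthominus (model_space (alpha * beta)) (model_space alpha)
      (Ct (alpha * f)).
    rewrite -tE; split=> [|g kg]; first exact: CtK.
    have kCg : model_space alpha (Ct g) by rewrite Ct1//; exact: stabA.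
    (* Being an isometric involution that preserves K_alpha, [Ct] preserves its orthogonal
       complement. *)
    rewrite -(CtI _ (subA _ kg)) CtP//; last exact: subA.
    apply: innerprod_eq0C; [exact: model_space_L2 kaf|exact: model_space_L2 kCg|].
    exact: model_space_orthogonal ia (model_space_H2 kf) kCg.
  move/(model_space_orthominus ia ib) => [F kF]; rewrite Ct2// psi2E.
  by move/(congr1 ( *%R (conjL alpha))); rewrite !unimodularKJ// => ->.
have [c2 [c21 c2E]] : exists c : R[i], `|c| = 1 /\
    forall f, model_space beta f -> psi * conjL f = cstL c * C_ beta f.
  (* For constant beta the model space is zero, and the value 1 is an arbitrary choice. *)
  have [cB|ncB] := pselect (constantL beta).
    exists 1; split=> [|f /(model_space_constant ib cB) ->]; first exact: normr1.
    by rewrite /C_ rmorph0 !mulr0.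
  have [c [cc cE]] := model_space_conj_multiplier ib ncB up stabB.
  by exists c; split=> // f _; rewrite cE -mulrA.
exists c1, c2; split=> //; split=> // f1 f2 k1 k2.
by rewrite CtS// psi2E c2E// [alpha * _]mulrCA psi1E -[_ * conjL f1]mulrA.
Qed.
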